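(* Let $T$ and $S$ be self-adjoint subspaces in $X^2$. If $T$ is a compact perturbation of $S$, then $\sigma_e(T)=\sigma_e(S)$; consequently $\sigma_e(S)=\emptyset$ if and only if $\sigma_e(T)=\emptyset$ (i.e. $S$ has purely discrete spectrum if and only if $T$ does).
   Context: $X$ is a complex Hilbert space and $X^2=X\times X$ carries the inner product $\langle (x,f),(y,g)\rangle=\langle x,y\rangle+\langle f,g\rangle$. A subspace $T$ in $X^2$ means a linear subspace of $X^2$ (a linear relation); a linear operator in $X$ is identified with its graph. Notation: $D(T)=\{x:(x,f)\in T \text{ for some } f\}$, $T^{-1}=\{(f,x):(x,f)\in T\}$, $\lambda I$ is the graph of $x\mapsto\lambda x$. The adjoint is $T^*=\{(y,g)\in X^2:\langle g,x\rangle=\langle y,f\rangle \text{ for all }(x,f)\in T\}$; $T$ is self-adjoint if $T=T^*$. Resolvent set: $\rho(T)=\{\lambda\in\mathbb C:(\lambda I-T)^{-1}$ is a bounded linear operator defined on all of $X\}$; spectrum $\sigma(T)=\mathbb C\setminus\rho(T)$. A number $\lambda$ is an eigenvalue of $T$ if $(x,\lambda x)\in T$ for some $x\ne 0$, with multiplicity the dimension of $\{x:(x,\lambda x)\in T\}$. The essential spectrum $\sigma_e(T)$ is the set of points of $\sigma(T)$ that are either accumulation points of $\sigma(T)$ or isolated eigenvalues of infinite multiplicity. Compact perturbation: for closed subspaces $T,S$ in $X^2$ with orthogonal projections $P_T,P_S$ of $X^2$ onto $T$, $S$, $T$ is a compact perturbation of $S$ if $P_T-P_S$ is a compact operator. 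*)

(* Defs.v *)
From Stdlib Require Import Reals.
Open Scope R_scope.
Set Implicit Arguments.

Record Cx := mkC { Cre : R; Cim : R }.
Definition C0 : Cx := mkC 0 0.
Definition C1 : Cx := mkC 1 0.
Definition Cadd (a b : Cx) : Cx := mkC (Cre a + Cre b) (Cim a + Cim b).
Definition Copp (a : Cx) : Cx := mkC (- Cre a) (- Cim a).
Definition Csub (a b : Cx) : Cx := Cadd a (Copp b).
Definition Cmul (a b : Cx) : Cx :=
  mkC (Cre a * Cre b - Cim a * Cim b) (Cre a * Cim b + Cim a * Cre b).
Definition Cconj (a : Cx) : Cx := mkC (Cre a) (- Cim a).
Definition Cabs (a : Cx) : R := sqrt (Cre a * Cre a + Cim a * Cim a).

Record Hilbert := {
  carrier :> Type;
  vzero : carrier;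
  vadd : carrier -> carrier -> carrier;
  vopp : carrier -> carrier;
  vscal : Cx -> carrier -> carrier;
  inner : carrier -> carrier -> Cx;
  vadd_assoc : forall x y z, vadd x (vadd y z) = vadd (vadd x y) z;
  vadd_comm : forall x y, vadd x y = vadd y x;
  vadd_0 : forall x, vadd x vzero = x;
  vadd_opp : forall x, vadd x (vopp x) = vzero;
  vscal_1 : forall x, vscal C1 x = x;
  vscal_assoc : forall a b x, vscal a (vscal b x) = vscal (Cmul a b) x;
  vscal_addv : forall a x y, vscal a (vadd x y) = vadd (vscal a x) (vscal a y);
  vscal_adds : forall a b x, vscal (Cadd a b) x = vadd (vscal a x) (vscal b x);
  inner_add : forall x y z, inner (vadd x y) z = Cadd (inner x z) (inner y z);
  inner_scal : forall a x y, inner (vscal a x) y = Cmul a (inner x y);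
  inner_conj : forall x y, inner y x = Cconj (inner x y);
  inner_pos : forall x, 0 <= Cre (inner x x);
  inner_def : forall x, inner x x = C0 -> x = vzero;
  complete : forall u : nat -> carrier,
    (forall eps, eps > 0 -> exists N, forall m n, (N <= m)%nat -> (N <= n)%nat ->
        sqrt (Cre (inner (vadd (u m) (vopp (u n))) (vadd (u m) (vopp (u n))))) < eps) ->
    exists l, forall eps, eps > 0 -> exists N, forall n, (N <= n)%nat ->
        sqrt (Cre (inner (vadd (u n) (vopp l)) (vadd (u n) (vopp l)))) < eps
}.

Arguments vzero {h}.
Arguments vadd {h}.
Arguments vopp {h}.
Arguments vscal {h}.
Arguments inner {h}.

Section Defs.
Variable X : Hilbert.

Definition vsub (x y : X) : X := vadd x (vopp y).
Definition hnorm (x : X) : R := sqrt (Cre (inner x x)).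

Definition X2 := (X * X)%type.
Definition zero2 : X2 := (vzero, vzero).
Definition add2 (p q : X2) : X2 := (vadd (fst p) (fst q), vadd (snd p) (snd q)).
Definition scal2 (a : Cx) (p : X2) : X2 := (vscal a (fst p), vscal a (snd p)).
Definition sub2 (p q : X2) : X2 := (vsub (fst p) (fst q), vsub (snd p) (snd q)).
Definition inner2 (p q : X2) : Cx :=
  Cadd (inner (fst p) (fst q)) (inner (snd p) (snd q)).
Definition norm2 (p : X2) : R := sqrt (Cre (inner2 p p)).

Definition relation2 := X2 -> Prop.

Definition is_subspace (T : relation2) : Prop :=
  T zero2 /\
  (forall p q, T p -> T q -> T (add2 p q)) /\
  (forall a p, T p -> T (scal2 a p)).

Definition adjoint (T : relation2) : relation2 :=
  fun yg => forall x f, T (x, f) -> inner (snd yg) x = inner (fst yg) f.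

Definition self_adjoint (T : relation2) : Prop :=
  forall p, T p <-> adjoint T p.

Definition closed_rel (T : relation2) : Prop :=
  forall (u : nat -> X2) l, (forall n, T (u n)) ->
    (forall eps, eps > 0 -> exists N, forall n, (N <= n)%nat ->
        norm2 (sub2 (u n) l) < eps) -> T l.

Definition orth_proj (T : relation2) (P : X2 -> X2) : Prop :=
  forall z, T (P z) /\ forall w, T w -> inner2 (sub2 z (P z)) w = C0.

Definition compact_op (K : X2 -> X2) : Prop :=
  forall u : nat -> X2, (exists M, forall n, norm2 (u n) <= M) ->
    exists (phi : nat -> nat) (l : X2),
      (forall n, (phi n < phi (S n))%nat) /\
      (forall eps, eps > 0 -> exists N, forall n, (N <= n)%nat ->
          norm2 (sub2 (K (u (phi n))) l) < eps).

Definition compact_perturbation (T S : relation2) : Prop :=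
  closed_rel T /\ closed_rel S /\
  exists PT PS, orth_proj T PT /\ orth_proj S PS /\
    compact_op (fun z => sub2 (PT z) (PS z)).

(* (lambda I - T)^{-1} = { (lambda x - f, x) : (x,f) in T } *)
Definition resolvent_rel (T : relation2) (lam : Cx) : relation2 :=
  fun p => exists x f, T (x, f) /\ p = (vsub (vscal lam x) f, x).

Definition in_resolvent (T : relation2) (lam : Cx) : Prop :=
  exists Rl : X -> X,
    (forall y x, resolvent_rel T lam (y, x) <-> x = Rl y) /\
    (forall y z, Rl (vadd y z) = vadd (Rl y) (Rl z)) /\
    (forall a y, Rl (vscal a y) = vscal a (Rl y)) /\
    (exists M, forall y, hnorm (Rl y) <= M * hnorm y).

Definition in_spectrum (T : relation2) (lam : Cx) : Prop := ~ in_resolvent T lam.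

Definition accumulation_pt (T : relation2) (lam : Cx) : Prop :=
  forall eps, eps > 0 -> exists mu, in_spectrum T mu /\ mu <> lam /\
    Cabs (Csub mu lam) < eps.

Definition eigenspace (T : relation2) (lam : Cx) (x : X) : Prop :=
  T (x, vscal lam x).

Definition is_eigenvalue (T : relation2) (lam : Cx) : Prop :=
  exists x, x <> vzero /\ eigenspace T lam x.

Fixpoint lin_comb (c : nat -> Cx) (v : nat -> X) (n : nat) : X :=
  match n with
  | O => vzero
  | S k => vadd (lin_comb c v k) (vscal (c k) (v k))
  end.

Definition lin_indep (n : nat) (v : nat -> X) : Prop :=
  forall c : nat -> Cx, lin_comb c v n = vzero -> forall i, (i < n)%nat -> c i = C0.

Definition infinite_multiplicity (T : relation2) (lam : Cx) : Prop :=
  forall n, exists v : nat -> X,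
    (forall i, (i < n)%nat -> eigenspace T lam (v i)) /\ lin_indep n v.

Definition in_ess_spectrum (T : relation2) (lam : Cx) : Prop :=
  in_spectrum T lam /\
  (accumulation_pt T lam \/
   (~ accumulation_pt T lam /\ is_eigenvalue T lam /\ infinite_multiplicity T lam)).

End Defs.

(* Main.v *)
(* Call [lam] singular for [T] if there are [(x_n, f_n)] in [T] with [x_n] bounded and
   uniformly separated and [f_n - lam x_n] Cauchy.  If [P_T - P_S] is compact, then along a
   subsequence [(x_n, f_n) - P_S (x_n, f_n) = (P_T - P_S) (x_n, f_n)] converges, so the
   [P_S (x_n, f_n)] witness that [lam] is singular for [S].  It remains to see that for
   self-adjoint [T] the singular points are exactly the essential spectrum.

   Approximate eigenvectors at distinct points of the (real) spectrum are almost orthogonal,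
   so an accumulation point of the spectrum is singular; at an eigenvalue of infinite
   multiplicity an orthonormal sequence of eigenvectors does it.  Conversely, a singular point
   is in the spectrum.  If it is isolated, at distance [2 d] from the rest, the resolvent
   estimate [1 / dist] at [lam + d] and [lam - d] shows that every [(x, f)] in [T] has an
   eigenvector [e] for [lam] with [d |x - e| <= |f - lam x|].  Hence the eigenspace contains
   a bounded separated sequence and is infinite-dimensional. *)

Require Import Defs.
From Stdlib Require Import Reals Lra Lia List Classical ClassicalEpsilon.

Arguments vsub {X} x y.
Arguments hnorm {X} x.
Arguments sub2 {X} p q.
Arguments inner2 {X} p q.
Arguments norm2 {X} p.
Arguments lin_comb {X} c v n.
Arguments lin_indep {X} n v.

(** * Algebra of the inner product and of its real part *)

Definition ip {X : Hilbert} (x y : X) : R := Cre (inner x y).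
Definition rsc {X : Hilbert} (r : R) (x : X) : X := vscal (mkC r 0) x.

Lemma Cx_ext (a b : Cx) : Cre a = Cre b -> Cim a = Cim b -> a = b.
Proof. destruct a, b; simpl; intros; subst; reflexivity. Qed.

Section Algebra.
Context {X : Hilbert}.
Implicit Types x y z : X.

Lemma inner_zero_l z : inner (@vzero X) z = C0.
Proof.
  pose proof (inner_add X vzero vzero z) as H. rewrite vadd_0 in H.
  apply (f_equal (fun a => (Cre a, Cim a))) in H. simpl in H. injection H; intros.
  apply Cx_ext; simpl; lra.
Qed.

Lemma inner_opp_l x z : inner (vopp x) z = Copp (inner x z).
Proof.
  pose proof (inner_add X x (vopp x) z) as H. rewrite vadd_opp, inner_zero_l in H.
  apply (f_equal (fun a => (Cre a, Cim a))) in H. simpl in H. injection H; intros.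
  apply Cx_ext; simpl; lra.
Qed.

Lemma inner_ext x y : (forall z, inner x z = inner y z) -> x = y.
Proof.
  intros H.
  assert (E : vadd x (vopp y) = vzero).
  { apply inner_def. rewrite inner_add, inner_opp_l, H.
    apply Cx_ext; simpl; lra. }
  rewrite <- (vadd_0 X x), <- (vadd_opp X y), (vadd_comm X y), vadd_assoc, E.
  rewrite vadd_comm, vadd_0. reflexivity.
Qed.
End Algebra.

(** Vector identities are tested against an arbitrary vector in the second slot; linearity in the
    first slot then leaves two real polynomial identities. *)
Ltac vec_eq :=
  intros; apply inner_ext; intro; unfold vsub, rsc;
  repeat (rewrite ?inner_add, ?inner_scal, ?inner_opp_l, ?inner_zero_l);
  apply Cx_ext; simpl; ring.

Section InnerProduct.
Context {X : Hilbert}.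
Implicit Types x y z : X.

Lemma ip_sym x y : ip x y = ip y x.
Proof. unfold ip. rewrite (inner_conj X y x). reflexivity. Qed.

Lemma ip_add_l x y z : ip (vadd x y) z = ip x z + ip y z.
Proof. unfold ip. rewrite inner_add. reflexivity. Qed.
Lemma ip_add_r x y z : ip z (vadd x y) = ip z x + ip z y.
Proof. rewrite !(ip_sym z). apply ip_add_l. Qed.
Lemma ip_sub_l x y z : ip (vsub x y) z = ip x z - ip y z.
Proof. unfold ip, vsub. rewrite inner_add, inner_opp_l. simpl. ring. Qed.
Lemma ip_sub_r x y z : ip z (vsub x y) = ip z x - ip z y.
Proof. rewrite !(ip_sym z). apply ip_sub_l. Qed.
Lemma ip_rsc_l r x z : ip (rsc r x) z = r * ip x z.
Proof. unfold ip, rsc. rewrite inner_scal. simpl. ring. Qed.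
Lemma ip_rsc_r r x z : ip z (rsc r x) = r * ip z x.
Proof. rewrite !(ip_sym z). apply ip_rsc_l. Qed.
Lemma ip_zero_l z : ip vzero z = 0.
Proof. unfold ip. rewrite inner_zero_l. reflexivity. Qed.
Lemma ip_zero_r z : ip z vzero = 0.
Proof. rewrite ip_sym. apply ip_zero_l. Qed.

Lemma ip_pos x : 0 <= ip x x.
Proof. apply inner_pos. Qed.

Lemma ip_def x : ip x x = 0 -> x = vzero.
Proof.
  intros H. apply inner_def. pose proof (inner_conj X x x) as E.
  apply (f_equal Cim) in E. simpl in E. unfold ip in H.
  apply Cx_ext; simpl; lra.
Qed.
End InnerProduct.

Ltac ip_expand :=
  repeat (rewrite ?ip_add_l, ?ip_add_r, ?ip_sub_l, ?ip_sub_r, ?ip_rsc_l, ?ip_rsc_r,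
          ?ip_zero_l, ?ip_zero_r).

(** * The Cauchy-Schwarz inequality and the norm *)

Section Norm.
Context {X : Hilbert}.
Implicit Types x y z : X.

(** The squared norm of [ip y y * x - ip x y * y] is nonnegative and has [ip y y] as a factor; a
    vanishing factor forces [y = vzero]. *)
Lemma cauchy_schwarz_sqr x y : ip x y * ip x y <= ip x x * ip y y.
Proof.
  destruct (Req_dec (ip y y) 0) as [E|E].
  - rewrite (ip_def y E). ip_expand. lra.
  - pose proof (ip_pos y) as Hy.
    pose proof (ip_pos (vsub (rsc (ip y y) x) (rsc (ip x y) y))) as H.
    revert H. ip_expand. rewrite (ip_sym y x). intros H.
    assert (0 <= ip y y * (ip x x * ip y y - ip x y * ip x y)) by nra.
    assert (0 < ip y y) by lra. nra.
Qed.

Lemma hnorm_pos x : 0 <= hnorm x.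
Proof. apply sqrt_pos. Qed.

Lemma hnorm_sqr x : hnorm x * hnorm x = ip x x.
Proof. apply sqrt_sqrt, ip_pos. Qed.

Lemma hnorm_le_sqr x r : 0 <= r -> ip x x <= r * r -> hnorm x <= r.
Proof.
  intros Hr H. rewrite <- hnorm_sqr in H. pose proof (hnorm_pos x). nra.
Qed.

Lemma hnorm_lt_sqr x r : 0 < r -> ip x x < r * r -> hnorm x < r.
Proof.
  intros Hr H. rewrite <- hnorm_sqr in H. pose proof (hnorm_pos x). nra.
Qed.

Lemma cauchy_schwarz x y : Rabs (ip x y) <= hnorm x * hnorm y.
Proof.
  pose proof (cauchy_schwarz_sqr x y) as H. rewrite <- !hnorm_sqr in H.
  pose proof (hnorm_pos x). pose proof (hnorm_pos y).
  apply Rsqr_incr_0_var; [|nra]. rewrite <- Rsqr_abs. unfold Rsqr. nra.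
Qed.

Lemma hnorm_add x y : hnorm (vadd x y) <= hnorm x + hnorm y.
Proof.
  pose proof (hnorm_pos x). pose proof (hnorm_pos y).
  apply hnorm_le_sqr; [lra|]. ip_expand. rewrite (ip_sym y x).
  pose proof (cauchy_schwarz x y). pose proof (Rle_abs (ip x y)).
  rewrite <- !hnorm_sqr. nra.
Qed.

Lemma hnorm_rsc r x : hnorm (rsc r x) = Rabs r * hnorm x.
Proof.
  pose proof (hnorm_pos x). pose proof (Rabs_pos r).
  apply Rsqr_inj; [apply hnorm_pos|nra|]. unfold Rsqr.
  rewrite hnorm_sqr. ip_expand. rewrite <- hnorm_sqr.
  pose proof (Rsqr_abs r). unfold Rsqr in *.
  transitivity ((r * r) * (hnorm x * hnorm x)); [ring|]. rewrite H1. ring.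
Qed.

Lemma hnorm_vsub_sym x y : hnorm (vsub x y) = hnorm (vsub y x).
Proof.
  replace (vsub x y) with (rsc (-1) (vsub y x)) by vec_eq.
  rewrite hnorm_rsc, (Rabs_left (-1)) by lra. ring.
Qed.

Lemma hnorm_sub x y : hnorm (vsub x y) <= hnorm x + hnorm y.
Proof.
  replace (vsub x y) with (vadd x (rsc (-1) y)) by vec_eq.
  pose proof (hnorm_add x (rsc (-1) y)) as H.
  rewrite hnorm_rsc, (Rabs_left (-1)) in H by lra. lra.
Qed.

Lemma hnorm_triangle x y z : hnorm (vsub x z) <= hnorm (vsub x y) + hnorm (vsub y z).
Proof.
  replace (vsub x z) with (vadd (vsub x y) (vsub y z)) by vec_eq. apply hnorm_add.
Qed.

Lemma hnorm_le_sub x y : hnorm x <= hnorm y + hnorm (vsub x y).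
Proof.
  pose proof (hnorm_add y (vsub x y)) as H.
  replace (vadd y (vsub x y)) with x in H by vec_eq. exact H.
Qed.

Lemma hnorm_vscal a x : hnorm (vscal a x) = Cabs a * hnorm x.
Proof.
  pose proof (hnorm_pos x). assert (0 <= Cabs a) by apply sqrt_pos.
  apply Rsqr_inj; [apply hnorm_pos|nra|]. unfold Rsqr.
  rewrite hnorm_sqr.
  assert (Ca : Cabs a * Cabs a = Cre a * Cre a + Cim a * Cim a).
  { apply sqrt_sqrt. nra. }
  transitivity ((Cabs a * Cabs a) * (hnorm x * hnorm x)); [|ring].
  rewrite Ca, hnorm_sqr. unfold ip. rewrite inner_scal, (inner_conj X (vscal a x) x), inner_scal.
  pose proof (inner_conj X x x) as E. apply (f_equal Cim) in E. simpl in E |- *.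
  assert (Cim (inner x x) = 0) by lra. rewrite H1. ring.
Qed.

Lemma hnorm_zero : hnorm (@vzero X) = 0.
Proof. unfold hnorm. rewrite inner_zero_l. apply sqrt_0. Qed.

Lemma hnorm_eq0 x : hnorm x = 0 -> x = vzero.
Proof. intros H. apply ip_def. rewrite <- hnorm_sqr, H. ring. Qed.

End Norm.

(** * Cauchy sequences and limits *)

Definition cauchy_seq {X : Hilbert} (u : nat -> X) : Prop :=
  forall eps, eps > 0 -> exists N, forall m n, (N <= m)%nat -> (N <= n)%nat ->
    hnorm (vsub (u m) (u n)) < eps.

Definition conv_to {X : Hilbert} (u : nat -> X) (l : X) : Prop :=
  forall eps, eps > 0 -> exists N, forall n, (N <= n)%nat -> hnorm (vsub (u n) l) < eps.

Section Limits.
Context {X : Hilbert}.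
Implicit Types (u v : nat -> X) (x y l : X).

Lemma cauchy_conv u : cauchy_seq u -> exists l, conv_to u l.
Proof. exact (complete X u). Qed.

Lemma conv_cauchy u l : conv_to u l -> cauchy_seq u.
Proof.
  intros H eps He. destruct (H (eps/2)) as [N HN]; [lra|]. exists N. intros m n Hm Hn.
  pose proof (HN m Hm). pose proof (HN n Hn). pose proof (hnorm_triangle (u m) l (u n)).
  rewrite (hnorm_vsub_sym l) in *. lra.
Qed.

Lemma cauchy_bounded u : cauchy_seq u -> exists M, forall n, hnorm (u n) <= M.
Proof.
  intros H. destruct (H 1) as [N HN]; [lra|].
  assert (F : forall k, exists M, forall n, (n < k)%nat -> hnorm (u n) <= M).
  { induction k as [|k [M HM]]; [exists 0; intros; lia|].
    exists (Rmax M (hnorm (u k))). intros n Hn.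
    destruct (Nat.eq_dec n k) as [->|]; [apply Rmax_r|].
    eapply Rle_trans; [apply HM; lia|apply Rmax_l]. }
  destruct (F N) as [M HM]. exists (Rmax M (hnorm (u N) + 1)). intros n.
  destruct (Nat.lt_ge_cases n N) as [L|L].
  - eapply Rle_trans; [apply HM, L|apply Rmax_l].
  - eapply Rle_trans; [|apply Rmax_r]. pose proof (HN n N L (le_n _)).
    pose proof (hnorm_le_sub (u n) (u N)). lra.
Qed.

Lemma conv_ext u v l : (forall n, u n = v n) -> conv_to u l -> conv_to v l.
Proof.
  intros E H eps He. destruct (H eps He) as [N HN]. exists N. intros. rewrite <- E. auto.
Qed.

Lemma conv_add u v x y : conv_to u x -> conv_to v y ->
  conv_to (fun n => vadd (u n) (v n)) (vadd x y).
Proof.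
  intros H1 H2 eps He. destruct (H1 (eps/2)) as [N1 HN1]; [lra|].
  destruct (H2 (eps/2)) as [N2 HN2]; [lra|]. exists (N1 + N2)%nat. intros n Hn.
  assert (A := HN1 n ltac:(lia)). assert (B := HN2 n ltac:(lia)).
  replace (vsub (vadd (u n) (v n)) (vadd x y))
    with (vadd (vsub (u n) x) (vsub (v n) y)) by vec_eq.
  pose proof (hnorm_add (vsub (u n) x) (vsub (v n) y)). lra.
Qed.

Lemma conv_const x : conv_to (fun _ => x) x.
Proof.
  intros eps He. exists 0%nat. intros.
  replace (vsub x x) with (@vzero X) by vec_eq. rewrite hnorm_zero. lra.
Qed.

Lemma conv_vscal a u x : conv_to u x -> conv_to (fun n => vscal a (u n)) (vscal a x).
Proof.
  intros H eps He. assert (P : 0 <= Cabs a) by apply sqrt_pos.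
  destruct (H (eps / (Cabs a + 1))) as [N HN].
  { apply Rdiv_lt_0_compat; lra. }
  exists N. intros n Hn. specialize (HN n Hn).
  replace (vsub (vscal a (u n)) (vscal a x)) with (vscal a (vsub (u n) x)) by vec_eq.
  rewrite hnorm_vscal. pose proof (hnorm_pos (vsub (u n) x)).
  apply Rmult_lt_compat_l with (r := Cabs a + 1) in HN; [|lra].
  replace ((Cabs a + 1) * (eps / (Cabs a + 1))) with eps in HN by (field; lra). lra.
Qed.

Lemma conv_sub u v x y : conv_to u x -> conv_to v y ->
  conv_to (fun n => vsub (u n) (v n)) (vsub x y).
Proof.
  intros H1 H2. replace (vsub x y) with (vadd x (vscal (mkC (-1) 0) y)) by vec_eq.
  apply conv_ext with (fun n => vadd (u n) (vscal (mkC (-1) 0) (v n))).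
  - intro; vec_eq.
  - apply conv_add; [exact H1|apply conv_vscal, H2].
Qed.

Lemma conv_hnorm_le u l M : conv_to u l -> (forall n, hnorm (u n) <= M) -> hnorm l <= M.
Proof.
  intros H B. apply Rnot_lt_le. intros L. destruct (H (hnorm l - M)) as [N HN]; [lra|].
  specialize (HN N (le_n _)). pose proof (hnorm_le_sub l (u N)).
  rewrite hnorm_vsub_sym in HN. specialize (B N). lra.
Qed.

End Limits.

Lemma INR_inv_small (eps : R) : eps > 0 ->
  exists N, forall n, (N <= n)%nat -> / (INR n + 1) < eps.
Proof.
  intros He. destruct (archimed_cor1 eps He) as [N [H1 H2]]. exists N. intros n Hn.
  eapply Rle_lt_trans; [|exact H1]. apply Rinv_le_contravar.
  - apply lt_0_INR; lia.
  - apply le_INR in Hn. lra.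
Qed.

Lemma INR_inv_pos n : 0 < / (INR n + 1).
Proof. apply Rinv_0_lt_compat. pose proof (pos_INR n). lra. Qed.

(** * Orthogonal projection and the resolvent set *)

Section Projection.
Context {X : Hilbert}.

(** The classical argument: a minimizing sequence for the distance from [y] to [V] is Cauchy by the
    parallelogram law, and its limit [p] admits no improving variation along [V]. *)
Lemma orthogonal_projection_exists (V : X -> Prop) (y : X) :
  V vzero ->
  (forall a b x z, V x -> V z -> V (vadd (rsc a x) (rsc b z))) ->
  (forall u l, (forall n, V (u n)) -> conv_to u l -> V l) ->
  exists p, V p /\ forall r, V r -> ip (vsub y p) r = 0.
Proof.
  intros V0 Vlin Vcl.
  (* [completeness] supplies suprema, so the infimum [d] of the squared distances is obtained from
     their negatives. *)
  set (E := fun t => exists r, V r /\ t = - ip (vsub y r) (vsub y r)).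
  destruct (completeness E) as [m [Hub Hlub]].
  { exists 0. intros t [r [_ ->]]. pose proof (ip_pos (vsub y r)). lra. }
  { exists (- ip (vsub y vzero) (vsub y vzero)), vzero. auto. }
  set (d := - m).
  assert (Hd : forall r, V r -> d <= ip (vsub y r) (vsub y r)).
  { intros r Hr. assert (- ip (vsub y r) (vsub y r) <= m) by (apply Hub; exists r; auto).
    unfold d; lra. }
  assert (Hn : forall n : nat, exists r, V r /\ ip (vsub y r) (vsub y r) < d + / (INR n + 1)).
  { intros n. apply NNPP. intros Hno. pose proof (INR_inv_pos n) as Pn.
    assert (m <= m - / (INR n + 1)); [|lra].
    apply Hlub. intros t [r [Hr ->]]. apply Rnot_lt_le. intros L.
    apply Hno. exists r. split; [exact Hr|]. unfold d. lra. }
  destruct (choice _ Hn) as [u Hu].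
  (* The midpoint of [u i] and [u j] lies in [V], hence at squared distance at least [d]; the
     parallelogram law then bounds the squared distance of [u i] and [u j] by four times
     [eps * eps / 4]. *)
  assert (Cu : cauchy_seq u).
  { intros eps He. destruct (@INR_inv_small (eps * eps / 4)) as [N HN]; [nra|].
    exists N. intros i j Hi Hj.
    pose proof (HN i Hi). pose proof (HN j Hj).
    destruct (Hu i) as [Vi Ei]. destruct (Hu j) as [Vj Ej].
    pose proof (Hd _ (Vlin (1/2) (1/2) _ _ Vi Vj)) as Em.
    apply hnorm_lt_sqr; [lra|]. revert Ei Ej Em. ip_expand.
    rewrite !(ip_sym (u i) y), !(ip_sym (u j) y), (ip_sym (u j) (u i)). lra. }
  destruct (cauchy_conv u Cu) as [p Hp].
  assert (Vp : V p) by (apply Vcl with u; [apply Hu|exact Hp]).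
  exists p. split; [exact Vp|]. intros r Hr.
  set (al := ip (vsub y p) r). apply NNPP. intros Hal.
  set (rho := ip r r). assert (Hrho : 0 <= rho) by apply ip_pos.
  (* Moving [p] by [s r] would change the squared distance by
     [-2 s al + s^2 rho = - s^2 (rho + 2) < 0]. The [+ 1] keeps the quotient defined when [r] is
     zero. *)
  set (s := al / (rho + 1)).
  assert (Hv : -2 * s * al + s * s * rho < 0).
  { replace (-2 * s * al + s * s * rho) with (- (s * s * (rho + 2))) by (unfold s; field; lra).
    assert (s <> 0). { unfold s. intros Z. apply Hal. apply (Rmult_eq_compat_r (rho + 1)) in Z.
      replace (al / (rho + 1) * (rho + 1)) with al in Z by (field; lra). lra. }
    assert (0 < s * s) by nra. nra. }
  set (v := -2 * s * al + s * s * rho) in *.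
  (* The variation is carried out at [u n] instead of [p]. Its two errors, [/ (INR n + 1)] and
     [2 s * ip (u n - p) r], are each kept below half of the gain [- v]. *)
  set (k := 2 * Rabs s * hnorm r + 1).
  assert (Hk : 0 < k).
  { unfold k. pose proof (Rabs_pos s). pose proof (hnorm_pos r). nra. }
  destruct (@INR_inv_small (- v / 2)) as [N1 HN1]; [lra|].
  destruct (Hp (- v / 2 / k)) as [N2 HN2].
  { apply Rdiv_lt_0_compat; lra. }
  set (n := (N1 + N2)%nat).
  specialize (HN1 n ltac:(lia)). specialize (HN2 n ltac:(lia)).
  destruct (Hu n) as [Vn En].
  pose proof (Hd _ (Vlin 1 s _ _ Vn Hr)) as H.
  assert (A : Rabs (ip (vsub (u n) p) r) <= hnorm (vsub (u n) p) * hnorm r)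
    by apply cauchy_schwarz.
  assert (B : Rabs (s * ip (vsub (u n) p) r) <= Rabs s * (hnorm (vsub (u n) p) * hnorm r)).
  { rewrite Rabs_mult. apply Rmult_le_compat_l; [apply Rabs_pos|exact A]. }
  assert (D : k * hnorm (vsub (u n) p) < - v / 2).
  { apply Rmult_lt_compat_l with (r := k) in HN2; [|exact Hk].
    replace (k * (- v / 2 / k)) with (- v / 2) in HN2 by (field; lra). exact HN2. }
  pose proof (hnorm_pos (vsub (u n) p)) as P0.
  assert (B2 : 2 * Rabs (s * ip (vsub (u n) p) r) < - v / 2).
  { unfold k in D. nra. }
  pose proof (Rle_abs (s * ip (vsub (u n) p) r)) as F.
  assert (E1 : ip (vsub (u n) p) r = al - ip (vsub y (u n)) r).
  { unfold al. ip_expand. ring. }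
  assert (E2 : ip (vsub y (vadd (rsc 1 (u n)) (rsc s r))) (vsub y (vadd (rsc 1 (u n)) (rsc s r)))
    = ip (vsub y (u n)) (vsub y (u n)) - 2 * s * ip (vsub y (u n)) r + s * s * rho).
  { unfold rho. ip_expand. rewrite !(ip_sym r). ip_expand.
    rewrite (ip_sym (u n) y). ring. }
  rewrite E2 in H. rewrite E1 in F, B2. unfold v in *. lra.
Qed.

End Projection.

Section Resolvent.
Context {X : Hilbert}.
Implicit Types (T : relation2 X) (x y f g : X).

Lemma inner_sub_r x y f : inner x (vsub y f) = Csub (inner x y) (inner x f).
Proof.
  unfold vsub. rewrite !(inner_conj X _ x), inner_add, inner_opp_l.
  apply Cx_ext; simpl; ring.
Qed.
Lemma inner_scal_r a x y : inner x (vscal a y) = Cmul (Cconj a) (inner x y).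
Proof. rewrite !(inner_conj X _ x), inner_scal. apply Cx_ext; simpl; ring. Qed.

(** The real part of [inner x (i y)] is the imaginary part of [inner x y], so real orthogonality to
    both [y] and [i y] is complex orthogonality to [y]. *)
Lemma inner_eq0 x y : ip x y = 0 -> ip x (vscal (mkC 0 1) y) = 0 -> inner x y = C0.
Proof.
  unfold ip. rewrite inner_scal_r. simpl. intros. apply Cx_ext; simpl; lra.
Qed.

Lemma subspace_scal T a x f : is_subspace T -> T (x, f) -> T (vscal a x, vscal a f).
Proof. intros [_ [_ H]] HT. exact (H a _ HT). Qed.
Lemma subspace_add T x f y g : is_subspace T -> T (x, f) -> T (y, g) -> T (vadd x y, vadd f g).
Proof. intros [_ [H _]] H1 H2. exact (H _ _ H1 H2). Qed.
Lemma subspace_comb T a b x f y g : is_subspace T -> T (x, f) -> T (y, g) ->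
  T (vadd (rsc a x) (rsc b y), vadd (rsc a f) (rsc b g)).
Proof.
  intros H H1 H2. apply subspace_add; auto.
  - exact (subspace_scal T (mkC a 0) x f H H1).
  - exact (subspace_scal T (mkC b 0) y g H H2).
Qed.
Lemma subspace_sub T x f y g : is_subspace T -> T (x, f) -> T (y, g) -> T (vsub x y, vsub f g).
Proof.
  intros H H1 H2. pose proof (subspace_comb T 1 (-1) x f y g H H1 H2) as E.
  replace (vsub x y) with (vadd (rsc 1 x) (rsc (-1) y)) by vec_eq.
  replace (vsub f g) with (vadd (rsc 1 f) (rsc (-1) g)) by vec_eq. exact E.
Qed.

Lemma closed_rel_conv T (u v : nat -> X) x f : closed_rel T ->
  (forall n, T (u n, v n)) -> conv_to u x -> conv_to v f -> T (x, f).
Proof.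
  intros Hc HT Hu Hv. apply (Hc (fun n => (u n, v n))); [exact HT|].
  intros eps He. destruct (Hu (eps / 2)) as [N1 H1]; [lra|].
  destruct (Hv (eps / 2)) as [N2 H2]; [lra|]. exists (N1 + N2)%nat. intros n Hn.
  specialize (H1 n ltac:(lia)). specialize (H2 n ltac:(lia)).
  pose proof (hnorm_pos (vsub (u n) x)). pose proof (hnorm_pos (vsub (v n) f)).
  unfold norm2, inner2, sub2. simpl.
  change (Cre (inner (vsub (u n) x) (vsub (u n) x)) + Cre (inner (vsub (v n) f) (vsub (v n) f)))
    with (ip (vsub (u n) x) (vsub (u n) x) + ip (vsub (v n) f) (vsub (v n) f)).
  rewrite <- !hnorm_sqr. rewrite <- (sqrt_square eps) by lra. apply sqrt_lt_1; nra.
Qed.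

Lemma self_adjoint_symmetric T x f y g :
  self_adjoint T -> T (x, f) -> T (y, g) -> inner f y = inner x g.
Proof. intros Hs H1 H2. exact (proj1 (Hs (x, f)) H1 y g H2). Qed.

(** The bound at [mu] makes the range of [T - mu] closed and the inverse single-valued and bounded.
    A vector orthogonal to the range is an eigenvector of the adjoint, which is [T], at the
    conjugate of [mu]; the second bound kills it, so the range is all of [X]. *)
Lemma in_resolvent_of_bounded_below T mu c :
  is_subspace T -> self_adjoint T -> closed_rel T -> c > 0 ->
  (forall x f, T (x, f) -> c * hnorm x <= hnorm (vsub f (vscal mu x))) ->
  (forall x f, T (x, f) -> c * hnorm x <= hnorm (vsub f (vscal (Cconj mu) x))) ->
  in_resolvent T mu.
Proof.
  intros Hsub Hsa Hcl Hc Hb Hb'.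
  set (V := fun r => exists x f, T (x, f) /\ r = vsub f (vscal mu x)).
  assert (Vscal : forall a r, V r -> V (vscal a r)).
  { intros a r (x & f & HT & ->). exists (vscal a x), (vscal a f).
    split; [apply subspace_scal; auto|vec_eq]. }
  assert (surj : forall y, exists x, resolvent_rel T mu (y, x)).
  { intros y. destruct (orthogonal_projection_exists V y) as (p & Vp & Hp).
    - exists vzero, vzero. split; [apply Hsub|vec_eq].
    - intros a b r r' (x & f & HT & ->) (x' & f' & HT' & ->).
      exists (vadd (rsc a x) (rsc b x')), (vadd (rsc a f) (rsc b f')).
      split; [apply subspace_comb; auto|vec_eq].
    - intros u l HV Hl. destruct (choice _ HV) as [w Hw]. destruct (choice _ Hw) as [g Hg].
      assert (Cw : cauchy_seq w).
      { intros eps He. destruct (conv_cauchy u l Hl (c * eps)) as [N HN]; [nra|].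
        exists N. intros i j Hi Hj. specialize (HN i j Hi Hj).
        destruct (Hg i) as [Ti Ei]. destruct (Hg j) as [Tj Ej].
        pose proof (Hb _ _ (subspace_sub T _ _ _ _ Hsub Ti Tj)) as B.
        replace (vsub (vsub (g i) (g j)) (vscal mu (vsub (w i) (w j)))) with (vsub (u i) (u j)) in B
          by (rewrite Ei, Ej; vec_eq).
        nra. }
      destruct (cauchy_conv w Cw) as [x Hx].
      exists x, (vadd l (vscal mu x)). split; [|vec_eq].
      apply closed_rel_conv with (u := w) (v := g); auto; [apply Hg|].
      apply conv_ext with (fun n => vadd (u n) (vscal mu (w n))).
      + intros n. rewrite (proj2 (Hg n)). vec_eq.
      + apply conv_add; [exact Hl|apply conv_vscal, Hx].
    - set (q := vsub y p).
      assert (Hq : T (q, vscal (Cconj mu) q)).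
      { apply Hsa. intros x f HT. simpl.
        assert (E : inner q (vsub f (vscal mu x)) = C0).
        { apply inner_eq0; apply Hp; [|apply Vscal]; exists x, f; auto. }
        rewrite inner_sub_r, inner_scal_r in E.
        rewrite inner_scal. apply (f_equal (fun a => (Cre a, Cim a))) in E.
        simpl in E. injection E; intros. apply Cx_ext; simpl; lra. }
      assert (E : q = vzero).
      { apply hnorm_eq0. pose proof (Hb' _ _ Hq) as B.
        replace (vsub (vscal (Cconj mu) q) (vscal (Cconj mu) q)) with (@vzero X) in B by vec_eq.
        rewrite hnorm_zero in B. pose proof (hnorm_pos q). nra. }
      destruct Vp as (x & f & HT & Ep).
      (* The minus sign is due to [resolvent_rel], which inverts [mu - T], while [V] is the range of
         [T - mu]. *)
      exists (vscal (mkC (-1) 0) x), (vscal (mkC (-1) 0) x), (vscal (mkC (-1) 0) f).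
      split; [apply subspace_scal; auto|]. f_equal.
      assert (Ey : y = vadd q p) by (unfold q; vec_eq).
      rewrite Ey, E, Ep. vec_eq. }
  assert (bnd : forall y x, resolvent_rel T mu (y, x) -> c * hnorm x <= hnorm y).
  { intros y x (x' & f & HT & E). injection E as -> ->. rewrite hnorm_vsub_sym. auto. }
  (* Coefficients [1, -1] will give uniqueness, [1, 1] additivity, and [a, 0] homogeneity of the
     inverse. *)
  assert (radd : forall a b y x y' x', resolvent_rel T mu (y, x) -> resolvent_rel T mu (y', x') ->
     resolvent_rel T mu (vadd (vscal a y) (vscal b y'), vadd (vscal a x) (vscal b x'))).
  { intros a b y x y' x' (z & f & HT & E) (z' & f' & HT' & E').
    injection E as -> ->. injection E' as -> ->.
    exists (vadd (vscal a z) (vscal b z')), (vadd (vscal a f) (vscal b f')).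
    split; [apply subspace_add; auto; apply subspace_scal; auto|]. f_equal. vec_eq. }
  assert (uniq : forall y x x', resolvent_rel T mu (y, x) -> resolvent_rel T mu (y, x') -> x = x').
  { intros y x x' H1 H2.
    pose proof (bnd _ _ (radd Defs.C1 (mkC (-1) 0) _ _ _ _ H1 H2)) as B.
    replace (vadd (vscal Defs.C1 y) (vscal (mkC (-1) 0) y)) with (@vzero X) in B by vec_eq.
    rewrite hnorm_zero in B.
    assert (Z : vadd (vscal Defs.C1 x) (vscal (mkC (-1) 0) x') = vzero).
    { apply hnorm_eq0. pose proof (hnorm_pos (vadd (vscal Defs.C1 x) (vscal (mkC (-1) 0) x'))). nra. }
    replace x with (vadd (vadd (vscal Defs.C1 x) (vscal (mkC (-1) 0) x')) x') by vec_eq.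
    rewrite Z. vec_eq. }
  destruct (choice _ surj) as [Rl HR]. exists Rl. repeat split.
  - intros H. apply (uniq y); auto.
  - intros ->. auto.
  - intros y z. apply (uniq (vadd y z)); auto.
    replace (vadd y z) with (vadd (vscal Defs.C1 y) (vscal Defs.C1 z)) by vec_eq.
    replace (vadd (Rl y) (Rl z)) with (vadd (vscal Defs.C1 (Rl y)) (vscal Defs.C1 (Rl z))) by vec_eq.
    auto.
  - intros a y. apply (uniq (vscal a y)); auto.
    replace (vscal a y) with (vadd (vscal a y) (vscal C0 y)) by vec_eq.
    replace (vscal a (Rl y)) with (vadd (vscal a (Rl y)) (vscal C0 (Rl y))) by vec_eq.
    auto.
  - exists (/ c). intros y. pose proof (bnd _ _ (HR y)) as B.
    apply Rmult_le_compat_l with (r := / c) in B.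
    + replace (/ c * (c * hnorm (Rl y))) with (hnorm (Rl y)) in B by (field; lra). exact B.
    + left. apply Rinv_0_lt_compat. lra.
Qed.

Lemma in_resolvent_bounded_below T mu : in_resolvent T mu ->
  exists c, c > 0 /\ forall x f, T (x, f) -> c * hnorm x <= hnorm (vsub f (vscal mu x)).
Proof.
  (* The sign of [M] is unknown; [Rabs M + 1] is a positive bound that dominates it. *)
  intros (Rl & H & _ & _ & M & HM). exists (/ (Rabs M + 1)).
  pose proof (Rabs_pos M). split; [apply Rinv_0_lt_compat; lra|]. intros x f HT.
  assert (E : x = Rl (vsub (vscal mu x) f)) by (apply H; exists x, f; auto).
  pose proof (HM (vsub (vscal mu x) f)) as B. rewrite <- E, (hnorm_vsub_sym _ f) in B.
  pose proof (hnorm_pos (vsub f (vscal mu x))). pose proof (Rle_abs M).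
  apply Rmult_le_reg_l with (Rabs M + 1); [lra|].
  rewrite <- Rmult_assoc, Rinv_r, Rmult_1_l by lra. nra.
Qed.

Lemma in_resolvent_onto T mu y : is_subspace T -> in_resolvent T mu ->
  exists x, T (x, vadd y (vscal mu x)).
Proof.
  intros Hs (Rl & H & _).
  destruct (proj2 (H (vscal (mkC (-1) 0) y) (Rl (vscal (mkC (-1) 0) y))) eq_refl)
    as (x & f & HT & E).
  injection E as E1 E2. exists x.
  replace (vadd y (vscal mu x)) with f; [exact HT|].
  replace y with (vscal (mkC (-1) 0) (vscal (mkC (-1) 0) y)) by vec_eq. rewrite E1. vec_eq.
Qed.

(** By symmetry [inner f x] is real, so the real part of [inner (f - mu x) (i x)] is [- Cim mu]
    times the squared norm of [x]; Cauchy-Schwarz does the rest. *)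
Lemma nonreal_bounded_below T mu x f : self_adjoint T -> T (x, f) ->
  Rabs (Cim mu) * hnorm x <= hnorm (vsub f (vscal mu x)).
Proof.
  intros Hsa HT.
  assert (E : ip (vsub f (vscal mu x)) (vscal (mkC 0 1) x) = - Cim mu * ip x x).
  { unfold ip. rewrite inner_scal_r. unfold vsub.
    rewrite inner_add, inner_opp_l, inner_scal.
    pose proof (self_adjoint_symmetric T x f x f Hsa HT HT) as S.
    rewrite (inner_conj X f x) in S. apply (f_equal Cim) in S.
    pose proof (f_equal Cim (inner_conj X x x)) as S'.
    simpl in *. nra. }
  pose proof (cauchy_schwarz (vsub f (vscal mu x)) (vscal (mkC 0 1) x)) as C.
  rewrite E, Rabs_mult, Rabs_Ropp, <- hnorm_sqr, hnorm_vscal in C.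
  replace (Cabs (mkC 0 1)) with 1 in C
    by (unfold Cabs; simpl; replace (0 * 0 + 1 * 1) with 1 by ring; symmetry; apply sqrt_1).
  rewrite (Rabs_right (hnorm x * hnorm x)) in C by (pose proof (hnorm_pos x); nra).
  pose proof (hnorm_pos x) as [P|P].
  - apply Rmult_le_reg_r with (hnorm x); [exact P|]. lra.
  - rewrite <- P, Rmult_0_r. apply hnorm_pos.
Qed.

Lemma spectrum_real T mu : is_subspace T -> self_adjoint T -> closed_rel T ->
  in_spectrum T mu -> Cim mu = 0.
Proof.
  intros Hs Hsa Hc Hmu. apply NNPP. intros Hn. apply Hmu.
  apply in_resolvent_of_bounded_below with (Rabs (Cim mu)); auto.
  - apply Rabs_pos_lt, Hn.
  - intros. apply (nonreal_bounded_below T); auto.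
  - intros. replace (Cim mu) with (- Cim (Cconj mu)) by (simpl; ring). rewrite Rabs_Ropp.
    apply (nonreal_bounded_below T); auto.
Qed.

(** Without such a vector, rescaling would bound [T - mu] below by [delta]. Since [mu] is real, this
    is also the bound at its conjugate, and [mu] would be in the resolvent set. *)
Lemma spectrum_approx_eigenvector T mu delta :
  is_subspace T -> self_adjoint T -> closed_rel T -> in_spectrum T mu -> delta > 0 ->
  exists x f, T (x, f) /\ hnorm x = 1 /\ hnorm (vsub f (vscal mu x)) < delta.
Proof.
  intros Hs Hsa Hc Hmu Hd. apply NNPP. intros Hno. apply Hmu.
  assert (B : forall x f, T (x, f) -> delta * hnorm x <= hnorm (vsub f (vscal mu x))).
  { intros x f HT. pose proof (hnorm_pos x) as [P|P].
    - apply Rnot_lt_le. intros L. apply Hno.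
      assert (Pi : 0 < / hnorm x) by (apply Rinv_0_lt_compat; lra).
      exists (rsc (/ hnorm x) x), (rsc (/ hnorm x) f).
      split; [exact (subspace_scal T (mkC (/ hnorm x) 0) x f Hs HT)|].
      split; [rewrite hnorm_rsc, Rabs_right; [field; lra|lra]|].
      replace (vsub (rsc (/ hnorm x) f) (vscal mu (rsc (/ hnorm x) x)))
        with (rsc (/ hnorm x) (vsub f (vscal mu x))) by vec_eq.
      rewrite hnorm_rsc, Rabs_right by lra.
      apply Rmult_lt_reg_l with (hnorm x); [exact P|].
      rewrite <- Rmult_assoc, Rinv_r by lra. lra.
    - rewrite <- P, Rmult_0_r. apply hnorm_pos. }
  apply in_resolvent_of_bounded_below with delta; auto.
  replace (Cconj mu) with mu; [exact B|].
  pose proof (spectrum_real T mu Hs Hsa Hc Hmu). apply Cx_ext; simpl; lra.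
Qed.

End Resolvent.

(** * Spectral gaps of symmetric relations *)

(** The gap arguments take place at real points, so linearity and symmetry are recorded over the
    reals, with [ip] as inner product. *)
Definition real_linear {X : Hilbert} (B : relation2 X) : Prop :=
  forall a b x f y g, B (x, f) -> B (y, g) ->
    B (vadd (rsc a x) (rsc b y), vadd (rsc a f) (rsc b g)).

Definition symmetric {X : Hilbert} (B : relation2 X) : Prop :=
  forall x f y g, B (x, f) -> B (y, g) -> ip f y = ip x g.

Definition bounded_below_at {X : Hilbert} (B : relation2 X) (s : R) : Prop :=
  exists c, c > 0 /\ forall x f, B (x, f) -> c * hnorm x <= hnorm (vsub f (rsc s x)).

Definition onto_at {X : Hilbert} (B : relation2 X) (s : R) : Prop :=
  forall y, exists x, B (x, vadd y (rsc s x)).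

Section Gap.
Context {X : Hilbert}.
Implicit Types (B : relation2 X) (x y f g u v w : X).

Lemma real_linear_scal B a x f : real_linear B -> B (x, f) -> B (rsc a x, rsc a f).
Proof.
  intros L H. pose proof (L a 0 _ _ _ _ H H) as E.
  replace (rsc a x) with (vadd (rsc a x) (rsc 0 x)) by vec_eq.
  replace (rsc a f) with (vadd (rsc a f) (rsc 0 f)) by vec_eq. exact E.
Qed.

Lemma real_linear_sub B x f y g : real_linear B -> B (x, f) -> B (y, g) ->
  B (vsub x y, vsub f g).
Proof.
  intros L H1 H2. pose proof (L 1 (-1) _ _ _ _ H1 H2) as E.
  replace (vsub x y) with (vadd (rsc 1 x) (rsc (-1) y)) by vec_eq.
  replace (vsub f g) with (vadd (rsc 1 f) (rsc (-1) g)) by vec_eq. exact E.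
Qed.

Lemma bounded_below_sqr B s : bounded_below_at B s ->
  exists c, c > 0 /\ forall x f, B (x, f) -> c * ip x x <= ip (vsub f (rsc s x)) (vsub f (rsc s x)).
Proof.
  intros (c & Hc & H). exists (c * c). split; [nra|]. intros x f HB. specialize (H x f HB).
  pose proof (hnorm_pos x). rewrite <- !hnorm_sqr.
  assert (0 <= c * hnorm x) by nra. nra.
Qed.

(* [m] is the squared norm of [A = B^-1].  Almost maximal vectors of [A] are
   almost eigenvectors of [A^2] for [m], so [B] fails to be bounded below at one
   of the points [1 / sqrt m], [- 1 / sqrt m]. *)
Lemma bounded_below_of_spectral_gap B d x0 f0 :
  real_linear B -> symmetric B -> d > 0 -> onto_at B 0 ->
  (forall s, Rabs s < d -> bounded_below_at B s) ->
  B (x0, f0) -> d * d * ip x0 x0 <= ip f0 f0.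
Proof.
  intros L S Hd On Bb H0. apply Rnot_lt_le. intros Hlt.
  assert (Bb0 : bounded_below_at B 0) by (apply Bb; rewrite Rabs_R0; lra).
  apply bounded_below_sqr in Bb0. destruct Bb0 as (c & Hc & Hbb).
  assert (Hb0 : forall x f, B (x, f) -> c * ip x x <= ip f f).
  { intros x f HB. specialize (Hbb x f HB).
    replace (vsub f (rsc 0 x)) with f in Hbb by vec_eq. exact Hbb. }
  assert (P0 : 0 < ip x0 x0).
  { pose proof (ip_pos f0). pose proof (ip_pos x0). nra. }
  assert (Pf : 0 < ip f0 f0). { pose proof (Hb0 _ _ H0). nra. }
  assert (norml : forall x f, B (x, f) -> 0 < ip f f ->
    exists x' f', B (x', f') /\ ip f' f' <= 1 /\ ip x x / ip f f = ip x' x').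
  { intros x f HB P. exists (rsc (/ hnorm f) x), (rsc (/ hnorm f) f).
    assert (Ph : 0 < hnorm f). { rewrite <- hnorm_sqr in P. pose proof (hnorm_pos f). nra. }
    split; [apply real_linear_scal; auto|]. ip_expand. rewrite <- (hnorm_sqr f).
    split; [right|]; field; lra. }
  set (E := fun t => exists x f, B (x, f) /\ ip f f <= 1 /\ t = ip x x).
  destruct (completeness E) as [m [Hub Hlub]].
  { exists (/ c). intros t (x & f & HB & H1 & ->). pose proof (Hb0 _ _ HB).
    apply Rmult_le_reg_l with c; [lra|]. rewrite Rinv_r; lra. }
  { destruct (norml _ _ H0 Pf) as (x & f & H). exists (ip x0 x0 / ip f0 f0), x, f. auto. }
  assert (Hm : ip x0 x0 / ip f0 f0 <= m).
  { apply Hub. destruct (norml _ _ H0 Pf) as (x & f & H). exists x, f. auto. }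
  assert (Hmd : 1 < d * d * m).
  { assert (1 < d * d * (ip x0 x0 / ip f0 f0)).
    { apply Rmult_lt_reg_r with (ip f0 f0); [exact Pf|].
      replace (d * d * (ip x0 x0 / ip f0 f0) * ip f0 f0) with (d * d * ip x0 x0)
        by (field; lra). lra. }
    assert (0 < d * d) by nra. nra. }
  assert (Pm : 0 < m). { assert (0 < d * d) by nra. nra. }
  assert (Hhom : forall x f, B (x, f) -> ip x x <= m * ip f f).
  { intros x f HB. pose proof (ip_pos f) as [P|P].
    - assert (Q : ip x x / ip f f <= m).
      { apply Hub. destruct (norml _ _ HB P) as (x' & f' & H). exists x', f'. auto. }
      apply Rmult_le_compat_r with (r := ip f f) in Q; [|lra].
      replace (ip x x / ip f f * ip f f) with (ip x x) in Q by (field; lra). exact Q.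
    - pose proof (Hb0 _ _ HB). pose proof (ip_pos x). rewrite <- P in *. nra. }
  (* The vector [x0] refuting the claim forces [1 < d^2 m], so both [s] and [- s] fall inside the
     gap. *)
  set (s := sqrt (/ m)).
  assert (Pim : 0 < / m) by (apply Rinv_0_lt_compat; lra).
  assert (Hs2 : s * s = / m) by (apply sqrt_sqrt; lra).
  assert (Ps : 0 < s) by (apply sqrt_lt_R0; exact Pim).
  assert (Hsd : s < d).
  { assert (s * s < d * d).
    { rewrite Hs2. apply Rmult_lt_reg_r with m; [lra|]. rewrite Rinv_l; lra. }
    nra. }
  destruct (bounded_below_sqr B s) as (c1 & Hc1 & B1).
  { apply Bb. rewrite Rabs_right; lra. }
  destruct (bounded_below_sqr B (- s)) as (c2 & Hc2 & B2).
  { apply Bb. rewrite Rabs_Ropp, Rabs_right; lra. }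
  (* Here [B^2 - 1 / m] factors as [(B - s) (B + s)], so the two lower bounds multiply. *)
  assert (B12 : forall v u y, B (v, u) -> B (u, y) ->
    c1 * c2 * ip v v <= ip (vsub y (rsc (/ m) v)) (vsub y (rsc (/ m) v))).
  { intros v u y Hv Hu.
    pose proof (B1 _ _ (L 1 s _ _ _ _ Hu Hv)) as A1.
    pose proof (B2 _ _ Hv) as A2.
    replace (vsub (vadd (rsc 1 y) (rsc s u)) (rsc s (vadd (rsc 1 u) (rsc s v))))
      with (vsub y (rsc (/ m) v)) in A1 by (rewrite <- Hs2; vec_eq).
    replace (vadd (rsc 1 u) (rsc s v)) with (vsub u (rsc (- s) v)) in A1 by vec_eq.
    nra. }
  set (k := c1 * c2) in *. assert (Pk : 0 < k) by (unfold k; nra).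
  (* The bound [eps <= m / 2] gives [ip u u >= m / 2] and then [ip v v >= m^2 / 4]. The estimate
     [m k * ip v v <= eps] thus yields [k m^3 / 4 <= eps], against [eps <= k m^3 / 8]. *)
  set (eps := Rmin (m / 2) (k * m * m * m / 8)).
  assert (Pe : 0 < eps).
  { apply Rmin_glb_lt; [lra|]. assert (0 < k * m) by nra. assert (0 < k * m * m) by nra. nra. }
  assert (He1 : eps <= m / 2) by apply Rmin_l.
  assert (He2 : eps <= k * m * m * m / 8) by apply Rmin_r.
  assert (Hex : exists u y, B (u, y) /\ ip y y <= 1 /\ m - eps < ip u u).
  { apply NNPP. intros Hno. assert (m <= m - eps); [|lra].
    apply Hlub. intros t (x & f & HB & H1 & ->). apply Rnot_lt_le. intros Hl.
    apply Hno. exists x, f. auto. }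
  destruct Hex as (u & y & Hu & Hy & Hmu).
  destruct (On u) as [v Hv]. replace (vadd u (rsc 0 v)) with u in Hv by vec_eq.
  pose proof (B12 _ _ _ Hv Hu) as A.
  pose proof (S _ _ _ _ Hv Hu) as Sv.
  pose proof (Hhom _ _ Hv) as Hvu.
  pose proof (cauchy_schwarz_sqr v y) as CS. rewrite <- Sv in CS.
  (* In the expansion the cross term is [ip v y = ip u u] by symmetry, and [ip v v <= m * ip u u] by
     maximality of [m]. *)
  assert (A' : ip (vsub y (rsc (/ m) v)) (vsub y (rsc (/ m) v)) <= 1 - / m * ip u u).
  { ip_expand. rewrite (ip_sym y v), <- Sv.
    assert (/ m * (/ m * ip v v) <= / m * ip u u).
    { apply Rmult_le_compat_l; [lra|]. apply Rmult_le_reg_l with m; [lra|].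
      rewrite <- Rmult_assoc, Rinv_r, Rmult_1_l by lra. exact Hvu. }
    lra. }
  assert (A2 : m * (k * ip v v) <= eps).
  { apply Rle_trans with (m * (1 - / m * ip u u)).
    - apply Rmult_le_compat_l; lra.
    - rewrite Rmult_minus_distr_l, <- Rmult_assoc, Rinv_r by lra. lra. }
  assert (Vv : m / 2 * (m / 2) <= ip v v).
  { pose proof (ip_pos v). assert (m / 2 * (m / 2) <= ip u u * ip u u) by nra. nra. }
  assert (m * (k * (m / 2 * (m / 2))) <= m * (k * ip v v)).
  { apply Rmult_le_compat_l; [lra|]. apply Rmult_le_compat_l; lra. }
  assert (0 < k * m * m * m).
  { assert (0 < k * m) by nra. assert (0 < k * m * m) by nra. nra. }
  nra.
Qed.

(* Apply the two lower bounds to [(x, f) + s (w, x)] and [(x, f) - s (w, x)]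
   with [s = -2 d] and add up. *)
Lemma gap_bounded_below_on_range B d w x f :
  real_linear B -> symmetric B -> d > 0 ->
  (forall y g, B (y, g) -> d * d * ip y y <= ip (vsub g (rsc d y)) (vsub g (rsc d y))) ->
  (forall y g, B (y, g) -> d * d * ip y y <= ip (vsub g (rsc (- d) y)) (vsub g (rsc (- d) y))) ->
  B (w, x) -> B (x, f) -> 2 * d * hnorm x <= hnorm f.
Proof.
  intros L S Hd Hp Hm Hw Hx.
  pose proof (Hm _ _ (L 1 (- (2 * d)) _ _ _ _ Hx Hw)) as A1.
  pose proof (Hp _ _ (L 1 (2 * d) _ _ _ _ Hx Hw)) as A2.
  pose proof (S _ _ _ _ Hw Hx) as Swx.
  revert A1 A2. ip_expand.
  rewrite !(ip_sym x f), !(ip_sym f w), !(ip_sym x w), <- !Swx. intros A1 A2.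
  assert (Q : 2 * d * (2 * d) * ip x x <= ip f f) by lra.
  rewrite <- !hnorm_sqr in Q. pose proof (hnorm_pos x). pose proof (hnorm_pos f). nra.
Qed.

(** The vectors [B (B - t)^-1 x] lie in the range of [B], where [gap_bounded_below_on_range]
    controls them. They converge as [t] decreases to 0, and [e] is [x] minus their limit. *)
Lemma kernel_approximation B d x f :
  real_linear B -> symmetric B -> closed_rel B -> d > 0 ->
  (forall y g, B (y, g) -> d * d * ip y y <= ip (vsub g (rsc d y)) (vsub g (rsc d y))) ->
  (forall y g, B (y, g) -> d * d * ip y y <= ip (vsub g (rsc (- d) y)) (vsub g (rsc (- d) y))) ->
  (forall t, 0 < t <= d -> onto_at B t) ->
  B (x, f) -> exists e, B (e, vzero) /\ d * hnorm (vsub x e) <= hnorm f.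
Proof.
  intros L S C Hd Hp Hm On Hx.
  set (t := fun n : nat => d * / (INR n + 1)).
  assert (Ht : forall n, 0 < t n <= d).
  { intros n. unfold t. pose proof (INR_inv_pos n). split; [nra|].
    assert (/ (INR n + 1) <= 1); [|nra].
    rewrite <- Rinv_1. apply Rinv_le_contravar; [lra|]. pose proof (pos_INR n). lra. }
  destruct (choice (fun n a => B (a, vadd x (rsc (t n) a)))) as [a Ha].
  { intros n. apply On, Ht. }
  (* With [a n = (B - t n)^-1 x], the pair [(a n, b n)] lies in [B]. *)
  set (b := fun n => vadd x (rsc (t n) (a n))).
  assert (Hb : forall n, B (b n, vadd f (rsc (t n) (b n)))).
  { intros n. pose proof (L 1 (t n) _ _ _ _ Hx (Ha n)) as H.
    replace (b n) with (vadd (rsc 1 x) (rsc (t n) (a n))) at 1 by (unfold b; vec_eq).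
    replace (vadd f (rsc (t n) (b n))) with (vadd (rsc 1 f) (rsc (t n) (b n))) by vec_eq.
    exact H. }
  (* The difference [x - b n] equals [- t n * a n], so [B] relates it to [- t n * b n], which tends
     to zero. Closedness will put the limit in the kernel. *)
  assert (He : forall n, B (vsub x (b n), rsc (- t n) (b n))).
  { intros n. pose proof (real_linear_scal B (- t n) _ _ L (Ha n)) as H.
    replace (vsub x (b n)) with (rsc (- t n) (a n)) by (unfold b; vec_eq). exact H. }
  (* The range estimate gives [2 d |b n| <= |f| + t n |b n|], and [t n <= d] lets the last term be
     absorbed. *)
  assert (Bb : forall n, d * hnorm (b n) <= hnorm f).
  { intros n.
    pose proof (gap_bounded_below_on_range B d _ _ _ L S Hd Hp Hm (Ha n) (Hb n)) as H.
    fold (b n) in H. pose proof (hnorm_add f (rsc (t n) (b n))) as H1.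
    rewrite hnorm_rsc, Rabs_right in H1 by (pose proof (Ht n); lra).
    pose proof (hnorm_pos (b n)). pose proof (Ht n). nra. }
  assert (tb : forall n, hnorm (rsc (- t n) (b n)) <= / (INR n + 1) * hnorm f).
  { intros n. rewrite hnorm_rsc, Rabs_Ropp, Rabs_right by (pose proof (Ht n); lra).
    unfold t. pose proof (INR_inv_pos n). specialize (Bb n). nra. }
  assert (small : forall eps, eps > 0 -> exists N, forall n, (N <= n)%nat ->
    hnorm (rsc (- t n) (b n)) < eps).
  { intros eps Hep. pose proof (hnorm_pos f) as Pf.
    destruct (INR_inv_small (eps / (hnorm f + 1))) as [N HN].
    { apply Rdiv_lt_0_compat; lra. }
    exists N. intros n Hn. specialize (HN n Hn). specialize (tb n).
    apply Rmult_lt_compat_r with (r := hnorm f + 1) in HN; [|lra].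
    replace (eps / (hnorm f + 1) * (hnorm f + 1)) with eps in HN by (field; lra).
    pose proof (INR_inv_pos n). nra. }
  assert (Cb : cauchy_seq b).
  { intros eps Hep. destruct (small (d * eps)) as [N HN]; [nra|].
    exists N. intros i j Hi Hj.
    pose proof (real_linear_sub B _ _ _ _ L (Ha i) (Ha j)) as H1.
    pose proof (real_linear_sub B _ _ _ _ L (Hb i) (Hb j)) as H2.
    pose proof (gap_bounded_below_on_range B d _ _ _ L S Hd Hp Hm H1 H2) as H.
    fold (b i) (b j) in H.
    replace (vsub (vadd f (rsc (t i) (b i))) (vadd f (rsc (t j) (b j))))
      with (vsub (rsc (- t j) (b j)) (rsc (- t i) (b i))) in H by vec_eq.
    pose proof (hnorm_sub (rsc (- t j) (b j)) (rsc (- t i) (b i))).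
    pose proof (HN i Hi). pose proof (HN j Hj). nra. }
  destruct (cauchy_conv b Cb) as [bl Hbl].
  exists (vsub x bl). split.
  - apply closed_rel_conv with (u := fun n => vsub x (b n)) (v := fun n => rsc (- t n) (b n)); auto.
    + apply conv_sub; [apply conv_const|exact Hbl].
    + intros eps Hep. destruct (small eps Hep) as [N HN]. exists N. intros n Hn.
      replace (vsub (rsc (- t n) (b n)) vzero) with (rsc (- t n) (b n)) by vec_eq. auto.
  - replace (vsub x (vsub x bl)) with bl by vec_eq.
    assert (hnorm bl <= hnorm f / d).
    { apply conv_hnorm_le with b; [exact Hbl|]. intros n. specialize (Bb n).
      apply Rmult_le_reg_l with d; [lra|].
      replace (d * (hnorm f / d)) with (hnorm f) by (field; lra). exact Bb. }
    apply Rmult_le_compat_l with (r := d) in H; [|lra].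
    replace (d * (hnorm f / d)) with (hnorm f) in H by (field; lra). exact H.
Qed.

End Gap.

(** * Infinite-dimensional subspaces *)

Lemma strictly_increasing (phi : nat -> nat) :
  (forall n, (phi n < phi (S n))%nat) -> forall j k, (j < k)%nat -> (phi j < phi k)%nat.
Proof. intros H j k L. induction L; [apply H|]. specialize (H m). lia. Qed.

Lemma bounded_close_subsequence (a : nat -> R) (M eps : R) :
  (forall n, Rabs (a n) <= M) -> eps > 0 ->
  exists phi : nat -> nat, (forall j k, (j < k)%nat -> (phi j < phi k)%nat) /\
    forall j k, Rabs (a (phi j) - a (phi k)) <= eps.
Proof.
  intros HM He.
  destruct (Bolzano_Weierstrass a (fun c => - M <= c <= M) (compact_P3 (- M) M)) as [l Hl].
  { intros n. specialize (HM n). pose proof (Rle_abs (a n)).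
    pose proof (Rle_abs (- a n)) as H'. rewrite Rabs_Ropp in H'. lra. }
  assert (H : forall N, exists p, (N <= p)%nat /\ Rabs (a p - l) < eps / 2).
  { intros N. assert (He2 : 0 < eps / 2) by lra.
    destruct (Hl (disc l (mkposreal (eps / 2) He2)) N) as [p [H1 H2]].
    - exists (mkposreal (eps / 2) He2). intros z Hz. exact Hz.
    - exists p. split; [exact H1|exact H2]. }
  destruct (choice _ H) as [p Hp].
  (* Searching from [S (phi k)] makes the indices strictly increase; all chosen values lie within
     [eps / 2] of the adherence value [l]. *)
  set (phi := fix phi n := match n with O => p O | S k => p (S (phi k)) end).
  exists phi. split.
  - apply strictly_increasing. intros n. simpl. destruct (Hp (S (phi n))). lia.
  - assert (A : forall n, Rabs (a (phi n) - l) < eps / 2) by (intros [|n]; apply Hp).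
    intros j k. pose proof (A j) as Aj. pose proof (A k) as Ak.
    apply Rabs_def2 in Aj. apply Rabs_def2 in Ak. apply Rabs_le. lra.
Qed.

(** A metric form of infinite dimension: it survives small perturbations of the vectors, which
    linear independence need not. *)
Definition bounded_separated {X : Hilbert} (V : X -> Prop) : Prop :=
  exists (z : nat -> X) (M s : R), s > 0 /\ (forall n, V (z n)) /\
    (forall n, hnorm (z n) <= M) /\
    forall j k, (j < k)%nat -> s <= hnorm (vsub (z j) (z k)).

Definition infinite_dim {X : Hilbert} (V : X -> Prop) : Prop :=
  forall n, exists v : nat -> X, (forall i, (i < n)%nat -> V (v i)) /\ lin_indep n v.

(** The common consequence of [bounded_separated] and [infinite_dim] for subspaces, and exactly what
    a Gram-Schmidt style choice consumes. *)
Definition unit_vectors_orthogonal_to_lists {X : Hilbert} (V : X -> Prop) : Prop :=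
  forall l : list X, exists w, V w /\ hnorm w = 1 /\ forall e, In e l -> ip w e = 0.

Section InfiniteDim.
Context {X : Hilbert}.
Implicit Types (V : X -> Prop) (v w : nat -> X) (c : nat -> Cx).

Lemma normalize V x : (forall a y, V y -> V (rsc a y)) -> V x -> x <> vzero ->
  V (rsc (/ hnorm x) x) /\ hnorm (rsc (/ hnorm x) x) = 1.
Proof.
  intros HV Hx Hn. split; [auto|].
  assert (hnorm x <> 0) by (intros E; apply Hn, hnorm_eq0, E).
  pose proof (hnorm_pos x). rewrite hnorm_rsc, Rabs_right; [field; auto|].
  left. apply Rinv_0_lt_compat. lra.
Qed.

(* The component along [e] is removed with a vector of [V] not orthogonal to [e];
   separation survives on a subsequence along which that component is almost constant. *)
Lemma bounded_separated_orth V e :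
  (forall a b x y, V x -> V y -> V (vadd (rsc a x) (rsc b y))) ->
  bounded_separated V -> bounded_separated (fun x => V x /\ ip x e = 0).
Proof.
  intros HV (z & M & s & Hs & Hz & HM & Hsep).
  destruct (classic (forall x, V x -> ip x e = 0)) as [H|H].
  { exists z, M, s. repeat split; auto. }
  apply not_all_ex_not in H. destruct H as [x H]. apply imply_to_and in H.
  destruct H as [Hx Hb]. set (b := ip x e) in *.
  set (a := fun n => ip (z n) e / b).
  set (Ma := M * hnorm e / Rabs b).
  assert (Pb : 0 < Rabs b) by (apply Rabs_pos_lt; exact Hb).
  assert (HMa : forall n, Rabs (a n) <= Ma).
  { intros n. unfold a, Ma, Rdiv. rewrite Rabs_mult, Rabs_inv.
    apply Rmult_le_compat_r; [left; apply Rinv_0_lt_compat; exact Pb|].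
    eapply Rle_trans; [apply cauchy_schwarz|]. apply Rmult_le_compat_r; [apply hnorm_pos|auto]. }
  pose proof (hnorm_pos x) as Px.
  destruct (bounded_close_subsequence a Ma (s / 2 / (hnorm x + 1)) HMa) as (phi & Hphi & Hcl).
  { apply Rdiv_lt_0_compat; lra. }
  exists (fun n => vadd (rsc 1 (z (phi n))) (rsc (- a (phi n)) x)), (M + Ma * hnorm x), (s / 2).
  split; [lra|]. split; [|split].
  - intros n. split; [apply HV; auto|]. ip_expand. fold b. unfold a. field. exact Hb.
  - intros n. eapply Rle_trans; [apply hnorm_add|]. rewrite !hnorm_rsc, Rabs_R1, Rabs_Ropp.
    pose proof (HMa (phi n)). pose proof (HM (phi n)). nra.
  - intros j k Hjk. pose proof (Hsep _ _ (Hphi _ _ Hjk)) as S. specialize (Hcl j k).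
    pose proof (hnorm_le_sub (vsub (z (phi j)) (z (phi k)))
      (vsub (vadd (rsc 1 (z (phi j))) (rsc (- a (phi j)) x))
            (vadd (rsc 1 (z (phi k))) (rsc (- a (phi k)) x)))) as T.
    replace (vsub (vsub (z (phi j)) (z (phi k))) _) with (rsc (a (phi j) - a (phi k)) x) in T
      by vec_eq.
    rewrite hnorm_rsc in T.
    assert (Rabs (a (phi j) - a (phi k)) * hnorm x <= s / 2); [|lra].
    apply Rle_trans with (s / 2 / (hnorm x + 1) * (hnorm x + 1)); [|right; field; lra].
    apply Rmult_le_compat; [apply Rabs_pos|exact Px|exact Hcl|lra].
Qed.

(** Induction on the list: the head [e] is disposed of by shrinking [V] to its vectors orthogonal to
    [e], and at the empty list a difference of two separated vectors is normalized. *)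
Lemma bounded_separated_unit_vectors V :
  (forall a b x y, V x -> V y -> V (vadd (rsc a x) (rsc b y))) ->
  bounded_separated V -> unit_vectors_orthogonal_to_lists V.
Proof.
  intros HV HS l. revert V HV HS. induction l as [|e l IH]; intros V HV HS.
  - destruct HS as (z & M & s & Hs & Hz & _ & Hsep). specialize (Hsep 0%nat 1%nat ltac:(lia)).
    destruct (normalize V (vsub (z 0%nat) (z 1%nat))) as [H1 H2].
    + intros a y Hy. replace (rsc a y) with (vadd (rsc a y) (rsc 0 y)) by vec_eq. auto.
    + replace (vsub (z 0%nat) (z 1%nat)) with (vadd (rsc 1 (z 0%nat)) (rsc (-1) (z 1%nat)))
        by vec_eq. auto.
    + intros E. rewrite E, hnorm_zero in Hsep. lra.
    + eexists. split; [exact H1|]. split; [exact H2|]. intros ? [].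
  - destruct (IH (fun x => V x /\ ip x e = 0)) as (w & [Vw We] & W1 & Wl).
    + intros a b x y [? Ex] [? Ey]. split; [auto|]. ip_expand. rewrite Ex, Ey. ring.
    + apply bounded_separated_orth; auto.
    + exists w. split; [exact Vw|]. split; [exact W1|]. intros e' [<-|H]; auto.
Qed.

Lemma orthonormal_sequence V : unit_vectors_orthogonal_to_lists V ->
  exists e : nat -> X, (forall n, V (e n)) /\ (forall n, hnorm (e n) = 1) /\
    forall j k, (j < k)%nat -> inner (e k) (e j) = C0.
Proof.
  intros H. destruct (choice _ H) as [ch Hch].
  (* Each vector enters the list together with its multiple by [i], so that [inner_eq0] upgrades
     real orthogonality to complex. *)
  set (prev := fix prev n := match n with
     | O => nil
     | S k => ch (prev k) :: vscal (mkC 0 1) (ch (prev k)) :: prev k end).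
  exists (fun n => ch (prev n)).
  assert (I : forall j k, (j < k)%nat ->
    In (ch (prev j)) (prev k) /\ In (vscal (mkC 0 1) (ch (prev j))) (prev k)).
  { intros j k L. induction L; simpl; intuition. }
  split; [|split]; try (intros; apply Hch).
  intros j k L. destruct (I j k L) as [I1 I2]. destruct (Hch (prev k)) as (_ & _ & O).
  apply inner_eq0; auto.
Qed.

Lemma lin_comb_ext c c' v v' n :
  (forall i, (i < n)%nat -> c i = c' i /\ v i = v' i) -> lin_comb c v n = lin_comb c' v' n.
Proof.
  intros H. induction n as [|n IH]; simpl; [reflexivity|].
  rewrite IH by (intros; apply H; lia). destruct (H n) as [-> ->]; [lia|reflexivity].
Qed.

(** Pairing a combination with [e i] returns its coefficient at [i]. *)
Lemma orthonormal_lin_indep (e : nat -> X) n :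
  (forall n, hnorm (e n) = 1) -> (forall j k, (j < k)%nat -> inner (e k) (e j) = C0) ->
  lin_indep n e.
Proof.
  intros H1 H2 c E i Hi.
  assert (Ho : forall j k, j <> k -> inner (e j) (e k) = C0).
  { intros j k Hjk. destruct (Nat.lt_ge_cases j k) as [L|L].
    - rewrite inner_conj, H2 by exact L. apply Cx_ext; simpl; ring.
    - apply H2. lia. }
  assert (Hd : inner (e i) (e i) = Defs.C1).
  { apply Cx_ext.
    - change (ip (e i) (e i) = 1). rewrite <- hnorm_sqr, H1. ring.
    - pose proof (f_equal Cim (inner_conj X (e i) (e i))) as S. simpl in *. lra. }
  assert (F : forall m, inner (lin_comb c e m) (e i) = if (i <? m)%nat then c i else C0).
  { induction m as [|m IH]; simpl lin_comb; [apply inner_zero_l|].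
    rewrite inner_add, inner_scal, IH. destruct (Nat.eq_dec m i) as [->|N].
    - rewrite Hd. destruct (Nat.ltb_spec i i); [lia|]. destruct (Nat.ltb_spec i (S i)); [|lia].
      apply Cx_ext; simpl; ring.
    - rewrite (Ho m i N). destruct (Nat.ltb_spec i m), (Nat.ltb_spec i (S m)); try lia;
        apply Cx_ext; simpl; ring. }
  specialize (F n). rewrite E, inner_zero_l in F. destruct (Nat.ltb_spec i n); [|lia]. auto.
Qed.

Lemma lin_comb_isolate c v n p : (p < n)%nat ->
  lin_comb c v n
  = vadd (lin_comb (fun i => if (i =? p)%nat then C0 else c i) v n) (vscal (c p) (v p)).
Proof.
  induction n as [|n IH]; intros Hp; [lia|]. simpl lin_comb.
  destruct (Nat.eqb_spec n p) as [->|N].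
  - rewrite (lin_comb_ext (fun i => if (i =? p)%nat then C0 else c i) c v v p); [vec_eq|].
    intros i Hi. destruct (Nat.eqb_spec i p); [lia|auto].
  - rewrite IH by lia. vec_eq.
Qed.

Lemma Cmul_eq0 a b : Cmul a b = C0 -> b <> C0 -> a = C0.
Proof.
  intros E Hb. assert (P : 0 < Cre b * Cre b + Cim b * Cim b).
  { apply Rnot_le_lt. intros L. apply Hb. apply Cx_ext; simpl; nra. }
  apply (f_equal (fun a => (Cre a, Cim a))) in E. simpl in E. injection E; intros E2 E1.
  assert (H1 : Cre a * (Cre b * Cre b + Cim b * Cim b) = 0).
  { transitivity ((Cre a * Cre b - Cim a * Cim b) * Cre b
      + (Cre a * Cim b + Cim a * Cre b) * Cim b); [ring|]. rewrite E1, E2. ring. }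
  assert (H2 : Cim a * (Cre b * Cre b + Cim b * Cim b) = 0).
  { transitivity ((Cre a * Cim b + Cim a * Cre b) * Cre b
      - (Cre a * Cre b - Cim a * Cim b) * Cim b); [ring|]. rewrite E1, E2. ring. }
  apply Rmult_integral in H1. apply Rmult_integral in H2.
  apply Cx_ext; simpl; [destruct H1|destruct H2]; lra.
Qed.

(* Gaussian elimination with pivot [v p], whose slot is refilled with [v n]; multiplying
   by the pivot instead of dividing keeps the elimination division-free. *)
Lemma lin_indep_orth V e n v :
  (forall x y, V x -> V y -> V (vadd x y)) -> (forall a x, V x -> V (vscal a x)) ->
  (forall i, (i < S n)%nat -> V (v i)) -> lin_indep (S n) v ->
  exists w, (forall i, (i < n)%nat -> V (w i) /\ inner (w i) e = C0) /\ lin_indep n w.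
Proof.
  intros HA HS HV Hind.
  destruct (classic (forall i, (i < S n)%nat -> inner (v i) e = C0)) as [H|H].
  (* If every [v i] is already orthogonal to [e], the last vector is dropped; a relation among the
     others extends by the coefficient 0. *)
  { exists v. split; [intros; split; [apply HV|apply H]; lia|].
    intros c E i Hi.
    specialize (Hind (fun j => if (j =? n)%nat then C0 else c j)). simpl in Hind.
    rewrite (lin_comb_ext _ c v v n), E, Nat.eqb_refl in Hind.
    - specialize (Hind ltac:(vec_eq) i ltac:(lia)). destruct (Nat.eqb_spec i n); [lia|exact Hind].
    - intros j Hj. destruct (Nat.eqb_spec j n); [lia|auto]. }
  apply not_all_ex_not in H. destruct H as [p H]. apply imply_to_and in H. destruct H as [Hp Hb].
  set (b := inner (v p) e) in *.
  set (v' := fun i => if (i =? p)%nat then v n else v i).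
  set (al := fun i => inner (v' i) e).
  assert (HV' : forall i, (i < n)%nat -> V (v' i)).
  { intros i Hi. unfold v'. destruct (i =? p)%nat; apply HV; lia. }
  exists (fun i => vadd (vscal b (v' i)) (vscal (Copp (al i)) (v p))). split.
  { intros i Hi. split; [apply HA; apply HS; auto|].
    rewrite inner_add, !inner_scal. fold b (al i). apply Cx_ext; simpl; ring. }
  intros c E.
  (* A combination of the eliminated vectors is [b] times the same combination of [v'], plus some
     multiple [t] of the pivot. *)
  assert (F : forall m, exists t,
    lin_comb c (fun i => vadd (vscal b (v' i)) (vscal (Copp (al i)) (v p))) m
    = vadd (vscal b (lin_comb c v' m)) (vscal t (v p))).
  { induction m as [|m [t IH]]; [exists C0; simpl; vec_eq|].
    exists (Cadd t (Cmul (c m) (Copp (al m)))). simpl lin_comb. rewrite IH. vec_eq. }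
  destruct (F n) as [t Ft]. rewrite E in Ft. clear F E.
  destruct (Nat.eq_dec p n) as [->|Np].
  - specialize (Hind (fun i => if (i =? n)%nat then t else Cmul b (c i))).
    intros i Hi. cbn [lin_comb] in Hind. rewrite Nat.eqb_refl in Hind.
    assert (G : lin_comb (fun i => if (i =? n)%nat then t else Cmul b (c i)) v n
      = vscal b (lin_comb c v' n)).
    { transitivity (lin_comb (fun i => Cmul b (c i)) v' n).
      - apply lin_comb_ext. intros j Hj. unfold v'. destruct (Nat.eqb_spec j n); [lia|auto].
      - generalize n. induction n0; simpl; [vec_eq|]. rewrite IHn0. vec_eq. }
    rewrite G, <- Ft in Hind. specialize (Hind eq_refl i ltac:(lia)).
    destruct (Nat.eqb_spec i n); [lia|].
    apply Cmul_eq0 with b; [|exact Hb]. rewrite <- Hind. apply Cx_ext; simpl; ring.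
  - assert (Hpn : (p < n)%nat) by lia.
    (* The relation read back on [v]: slot [n] receives the coefficient of [v' p], which is [v n],
       and slot [p] receives the accumulated coefficient [t] of the pivot. *)
    set (d := fun i => if (i =? n)%nat then Cmul b (c p) else
                       if (i =? p)%nat then t else Cmul b (c i)).
    assert (G : lin_comb d v (S n) = vzero).
    { cbn [lin_comb]. rewrite (lin_comb_isolate d v n p Hpn).
      rewrite (lin_comb_isolate c v' n p Hpn) in Ft.
      assert (dn : d n = Cmul b (c p)) by (unfold d; rewrite Nat.eqb_refl; auto).
      assert (dp : d p = t).
      { unfold d. rewrite Nat.eqb_refl. destruct (Nat.eqb_spec p n); [lia|auto]. }
      assert (vp : v' p = v n) by (unfold v'; rewrite Nat.eqb_refl; auto).
      rewrite dn, dp, vp in *.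
      assert (K : lin_comb (fun i => if (i =? p)%nat then C0 else d i) v n
        = vscal b (lin_comb (fun i => if (i =? p)%nat then C0 else c i) v' n)).
      { assert (K' : forall m, (m <= n)%nat ->
          lin_comb (fun i => if (i =? p)%nat then C0 else d i) v m
          = vscal b (lin_comb (fun i => if (i =? p)%nat then C0 else c i) v' m)).
        { induction m as [|m IH]; intros Hm; simpl lin_comb; [vec_eq|].
          rewrite IH by lia. unfold d, v'. destruct (Nat.eqb_spec m p); [vec_eq|].
          destruct (Nat.eqb_spec m n); [lia|]. vec_eq. }
        apply K'. lia. }
      rewrite K, Ft. vec_eq. }
    specialize (Hind d G). intros i Hi.
    apply Cmul_eq0 with b; [|exact Hb].
    destruct (Nat.eq_dec i p) as [->|Nip].
    + rewrite <- (Hind n ltac:(lia)). unfold d. rewrite Nat.eqb_refl. apply Cx_ext; simpl; ring.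
    + rewrite <- (Hind i ltac:(lia)). unfold d. destruct (Nat.eqb_spec i n); [lia|].
      destruct (Nat.eqb_spec i p); [lia|]. apply Cx_ext; simpl; ring.
Qed.

(** Same induction as for separated sequences; [lin_indep_orth] shows that passing to the vectors
    orthogonal to [e] costs one dimension at most. *)
Lemma infinite_dim_unit_vectors V :
  (forall x y, V x -> V y -> V (vadd x y)) -> (forall a x, V x -> V (vscal a x)) ->
  infinite_dim V -> unit_vectors_orthogonal_to_lists V.
Proof.
  intros HA HS HI l. revert V HA HS HI. induction l as [|e l IH]; intros V HA HS HI.
  - destruct (HI 1%nat) as (v & Hv & Hind).
    destruct (normalize V (v 0%nat)) as [H1 H2].
    + intros a y Hy. apply HS, Hy.
    + apply Hv. lia.
    + intros E. specialize (Hind (fun _ => Defs.C1)). simpl in Hind. rewrite E in Hind.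
      specialize (Hind ltac:(vec_eq) 0%nat ltac:(lia)).
      apply (f_equal Cre) in Hind. simpl in Hind. lra.
    + eexists. split; [exact H1|]. split; [exact H2|]. intros ? [].
  - destruct (IH (fun x => V x /\ inner x e = C0)) as (w & [Vw We] & W1 & Wl).
    + intros x y [? Ex] [? Ey]. split; [auto|]. rewrite inner_add, Ex, Ey.
      apply Cx_ext; simpl; ring.
    + intros a x [? Ex]. split; [auto|]. rewrite inner_scal, Ex. apply Cx_ext; simpl; ring.
    + intros n. destruct (HI (S n)) as (v & Hv & Hind). apply (lin_indep_orth V e n v); auto.
    + exists w. split; [exact Vw|]. split; [exact W1|]. intros e' [<-|H]; [|auto].
      unfold ip. rewrite We. reflexivity.
Qed.

End InfiniteDim.

(** * Singular sequences *)

(** Asking [f n - lam x n] to be Cauchy rather than null lets the notion absorb the convergent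
    correction of a compact perturbation. *)
Definition singular {X : Hilbert} (T : relation2 X) (lam : Cx) : Prop :=
  exists (x f : nat -> X) (M s : R), s > 0 /\ (forall n, T (x n, f n)) /\
    (forall n, hnorm (x n) <= M) /\
    cauchy_seq (fun n => vsub (f n) (vscal lam (x n))) /\
    forall j k, (j < k)%nat -> s <= hnorm (vsub (x j) (x k)).

(** The relation [T - m], which moves the real point [m] to 0. *)
Definition shift {X : Hilbert} (T : relation2 X) (m : R) : relation2 X :=
  fun p => T (fst p, vadd (snd p) (rsc m (fst p))).

Section Shift.
Context {X : Hilbert}.
Implicit Types (T : relation2 X) (m s : R).

Lemma shift_real_linear T m : is_subspace T -> real_linear (shift T m).
Proof.
  unfold shift. intros Hs a b x f y g H1 H2. simpl in *.
  pose proof (subspace_comb T a b _ _ _ _ Hs H1 H2) as H.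
  replace (vadd (vadd (rsc a f) (rsc b g)) (rsc m (vadd (rsc a x) (rsc b y))))
    with (vadd (rsc a (vadd f (rsc m x))) (rsc b (vadd g (rsc m y)))) by vec_eq. exact H.
Qed.

Lemma shift_symmetric T m : self_adjoint T -> symmetric (shift T m).
Proof.
  unfold shift. intros Hs x f y g H1 H2. simpl in *.
  pose proof (f_equal Cre (self_adjoint_symmetric T _ _ _ _ Hs H1 H2)) as E.
  fold (ip (vadd f (rsc m x)) y) (ip x (vadd g (rsc m y))) in E. revert E. ip_expand. lra.
Qed.

Lemma norm2_fst (p : X2 X) : hnorm (fst p) <= norm2 p.
Proof.
  unfold hnorm, norm2, inner2. apply sqrt_le_1_alt. simpl.
  pose proof (ip_pos (snd p)) as H. unfold ip in H. lra.
Qed.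

Lemma norm2_snd (p : X2 X) : hnorm (snd p) <= norm2 p.
Proof.
  unfold hnorm, norm2, inner2. apply sqrt_le_1_alt. simpl.
  pose proof (ip_pos (fst p)) as H. unfold ip in H. lra.
Qed.

Lemma norm2_le (p : X2 X) : norm2 p <= hnorm (fst p) + hnorm (snd p).
Proof.
  pose proof (hnorm_pos (fst p)). pose proof (hnorm_pos (snd p)).
  rewrite <- (sqrt_square (hnorm (fst p) + hnorm (snd p))) by lra.
  unfold norm2, inner2. apply sqrt_le_1_alt. simpl.
  fold (ip (fst p) (fst p)) (ip (snd p) (snd p)). rewrite <- !hnorm_sqr. nra.
Qed.

Lemma shift_closed T m : closed_rel T -> closed_rel (shift T m).
Proof.
  intros Hc u l Hu Hl. unfold shift.
  apply closed_rel_conv with (u := fun n => fst (u n))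
    (v := fun n => vadd (snd (u n)) (rsc m (fst (u n)))); auto.
  - intros eps He. destruct (Hl eps He) as [N HN]. exists N. intros n Hn.
    eapply Rle_lt_trans; [apply (norm2_fst (sub2 (u n) l))|auto].
  - apply conv_add; [|apply (conv_vscal (mkC m 0))];
      intros eps He; destruct (Hl eps He) as [N HN]; exists N; intros n Hn.
    + eapply Rle_lt_trans; [apply (norm2_snd (sub2 (u n) l))|auto].
    + eapply Rle_lt_trans; [apply (norm2_fst (sub2 (u n) l))|auto].
Qed.

Lemma shift_bounded_below T m s :
  in_resolvent T (mkC (m + s) 0) -> bounded_below_at (shift T m) s.
Proof.
  intros H. destruct (in_resolvent_bounded_below T _ H) as (c & Hc & Hb).
  exists c. split; [exact Hc|]. intros x f HT. specialize (Hb _ _ HT). simpl in Hb.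
  replace (vsub f (rsc s x)) with (vsub (vadd f (rsc m x)) (vscal (mkC (m + s) 0) x)) by vec_eq.
  exact Hb.
Qed.

Lemma shift_onto T m s : is_subspace T ->
  in_resolvent T (mkC (m + s) 0) -> onto_at (shift T m) s.
Proof.
  intros Hs H y. destruct (in_resolvent_onto T _ y Hs H) as [x Hx]. exists x.
  unfold shift. simpl.
  replace (vadd (vadd y (rsc s x)) (rsc m x)) with (vadd y (vscal (mkC (m + s) 0) x)) by vec_eq.
  exact Hx.
Qed.

(** The resolvent estimate [1 / dist] in squared form, read off from the gap of [T - m] around 0. *)
Lemma resolvent_interval_bound T m d x f :
  is_subspace T -> self_adjoint T -> d > 0 ->
  (forall s, Rabs s < d -> in_resolvent T (mkC (m + s) 0)) ->
  T (x, f) -> d * d * ip x x <= ip (vsub f (rsc m x)) (vsub f (rsc m x)).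
Proof.
  intros Hs Hsa Hd Hr HT.
  apply bounded_below_of_spectral_gap with (B := shift T m); auto.
  - apply shift_real_linear, Hs.
  - apply shift_symmetric, Hsa.
  - apply shift_onto; auto. apply Hr. rewrite Rabs_R0. lra.
  - intros s H. apply shift_bounded_below. auto.
  - unfold shift. simpl. replace (vadd (vsub f (rsc m x)) (rsc m x)) with f by vec_eq. exact HT.
Qed.

End Shift.

(** * Singular points and the essential spectrum *)

Section Singular.
Context {X : Hilbert}.
Implicit Types (T S : relation2 X) (lam : Cx).

(** At a resolvent point the lower bound would make [x n] Cauchy along with [f n - lam x n], against
    separation. *)
Lemma singular_in_spectrum T lam : is_subspace T -> singular T lam -> in_spectrum T lam.
Proof.
  intros Hs (x & f & M & s & Ps & HT & _ & HC & Hsep) Hr.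
  destruct (in_resolvent_bounded_below T lam Hr) as (c & Hc & Hb).
  destruct (HC (c * s)) as [N HN]; [nra|].
  specialize (HN N (N + 1)%nat ltac:(lia) ltac:(lia)).
  specialize (Hsep N (N + 1)%nat ltac:(lia)).
  pose proof (Hb _ _ (subspace_sub T _ _ _ _ Hs (HT N) (HT (N + 1)%nat))) as B.
  replace (vsub (vsub (f N) (f (N + 1)%nat)) (vscal lam (vsub (x N) (x (N + 1)%nat))))
    with (vsub (vsub (f N) (vscal lam (x N))) (vsub (f (N + 1)%nat) (vscal lam (x (N + 1)%nat))))
    in B by vec_eq.
  nra.
Qed.

(** Differences of far terms of the singular sequence have small defect, so [kernel_approximation]
    puts eigenvectors near them without destroying separation. *)
Lemma isolated_singular_kernel T l d :
  is_subspace T -> self_adjoint T -> closed_rel T -> d > 0 ->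
  (forall t, t <> 0 -> Rabs t < 2 * d -> in_resolvent T (mkC (l + t) 0)) ->
  singular T (mkC l 0) -> bounded_separated (eigenspace T (mkC l 0)).
Proof.
  intros Hs Hsa Hcl Hd Hr (x & f & M & s & Ps & HT & HM & HC & Hsep).
  set (B := shift T l).
  assert (Hshift : forall y g, B (y, g) -> forall t,
     vsub g (rsc t y) = vsub (vadd g (rsc l y)) (rsc (l + t) y)) by (intros; vec_eq).
  assert (K : forall y g, B (y, g) ->
    exists e, B (e, vzero) /\ d * hnorm (vsub y e) <= hnorm g).
  { intros y g HB. apply kernel_approximation; auto.
    - apply shift_real_linear, Hs.
    - apply shift_symmetric, Hsa.
    - apply shift_closed, Hcl.
    - intros y' g' H. rewrite (Hshift _ _ H).
      (* The open interval of radius [d] about [l + d] misses [l] and stays within [2 d] of it;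
         likewise about [l - d] below. *)
      apply resolvent_interval_bound with T; auto.
      intros r Hrd. apply Rabs_def2 in Hrd.
      replace (l + d + r) with (l + (d + r)) by ring. apply Hr; [lra|].
      apply Rabs_def1; lra.
    - intros y' g' H. rewrite (Hshift _ _ H).
      apply resolvent_interval_bound with T; auto.
      intros r Hrd. apply Rabs_def2 in Hrd.
      replace (l + - d + r) with (l + (- d + r)) by ring. apply Hr; [lra|].
      apply Rabs_def1; lra.
    - intros t Ht. apply shift_onto; auto. apply Hr; [lra|]. rewrite Rabs_right; lra. }
  (* A defect below [d s / 4] leaves an eigenvector within [s / 4]; two such errors reduce the
     separation [s] to [s / 2]. *)
  destruct (HC (d * s / 4)) as [N HN]; [nra|].
  set (g := fun k => vsub (f (N + k)%nat) (rsc l (x (N + k)%nat))).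
  assert (Hk : forall k, exists e, B (e, vzero) /\
     hnorm (vsub (vsub (x (N + k)%nat) (x N)) e) <= s / 4).
  { intros k.
    destruct (K (vsub (x (N + k)%nat) (x N)) (vsub (g k) (vsub (f N) (rsc l (x N)))))
      as (e & He & Hd').
    - unfold B, shift. simpl.
      replace (vadd _ _) with (vsub (f (N + k)%nat) (f N)) by (unfold g; vec_eq).
      apply subspace_sub; auto.
    - exists e. split; [exact He|]. specialize (HN (N + k)%nat N ltac:(lia) ltac:(lia)).
      unfold g in Hd'. unfold rsc in *. nra. }
  destruct (choice _ Hk) as [e He].
  exists e, (2 * M + s / 4), (s / 2). split; [lra|]. split; [|split].
  - intros n. unfold eigenspace. destruct (He n) as [H _]. unfold B, shift in H. simpl in H.
    replace (vscal (mkC l 0) (e n)) with (vadd vzero (rsc l (e n))) by vec_eq. exact H.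
  - intros n. destruct (He n) as [_ H].
    pose proof (hnorm_le_sub (e n) (vsub (x (N + n)%nat) (x N))) as A.
    rewrite hnorm_vsub_sym in H.
    pose proof (hnorm_sub (x (N + n)%nat) (x N)). pose proof (HM N). pose proof (HM (N + n)%nat). lra.
  - intros j k Hjk. specialize (Hsep (N + j)%nat (N + k)%nat ltac:(lia)).
    destruct (He j) as [_ H1]. destruct (He k) as [_ H2].
    pose proof (hnorm_le_sub (vsub (x (N + j)%nat) (x (N + k)%nat)) (vsub (e j) (e k))) as A.
    replace (vsub (vsub (x (N + j)%nat) (x (N + k)%nat)) (vsub (e j) (e k)))
      with (vsub (vsub (vsub (x (N + j)%nat) (x N)) (e j)) (vsub (vsub (x (N + k)%nat) (x N)) (e k)))
      in A by vec_eq.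
    pose proof (hnorm_sub (vsub (vsub (x (N + j)%nat) (x N)) (e j))
      (vsub (vsub (x (N + k)%nat) (x N)) (e k))). lra.
Qed.

Lemma eigenspace_add T lam x y : is_subspace T ->
  eigenspace T lam x -> eigenspace T lam y -> eigenspace T lam (vadd x y).
Proof.
  unfold eigenspace. intros Hs H1 H2.
  replace (vscal lam (vadd x y)) with (vadd (vscal lam x) (vscal lam y)) by vec_eq.
  apply subspace_add; auto.
Qed.

Lemma eigenspace_scal T lam a x : is_subspace T ->
  eigenspace T lam x -> eigenspace T lam (vscal a x).
Proof.
  unfold eigenspace. intros Hs H.
  replace (vscal lam (vscal a x)) with (vscal a (vscal lam x)) by vec_eq.
  apply subspace_scal; auto.
Qed.

Lemma Cabs_real (r : R) : Cabs (mkC r 0) = Rabs r.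
Proof.
  unfold Cabs. simpl. replace (r * r + 0 * 0) with (Rsqr r) by (unfold Rsqr; ring).
  apply sqrt_Rsqr_abs.
Qed.

(** Away from accumulation the eigenspace contains a bounded separated sequence, hence an
    orthonormal one, which supplies the eigenvector and the infinite multiplicity at once. *)
Lemma singular_ess_spectrum T lam :
  is_subspace T -> self_adjoint T -> closed_rel T -> singular T lam -> in_ess_spectrum T lam.
Proof.
  intros Hs Hsa Hcl Hsing. pose proof (singular_in_spectrum T lam Hs Hsing) as Hsp.
  split; [exact Hsp|].
  destruct (classic (accumulation_pt T lam)) as [Ha|Ha]; [left; exact Ha|right].
  split; [exact Ha|].
  pose proof (spectrum_real T lam Hs Hsa Hcl Hsp) as Hre.
  destruct lam as [l li]. simpl in Hre. subst li.
  apply not_all_ex_not in Ha. destruct Ha as [eps Ha]. apply imply_to_and in Ha.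
  destruct Ha as [He Ha].
  assert (BS : bounded_separated (eigenspace T (mkC l 0))).
  { apply isolated_singular_kernel with (eps / 2); auto; [lra|]. intros t Ht Hlt.
    apply NNPP. intros Hn. apply Ha. exists (mkC (l + t) 0). split; [exact Hn|]. split.
    - intros E. injection E. lra.
    - replace (Csub (mkC (l + t) 0) (mkC l 0)) with (mkC t 0) by (apply Cx_ext; simpl; ring).
      rewrite Cabs_real. lra. }
  destruct (orthonormal_sequence (eigenspace T (mkC l 0))) as (e & E1 & E2 & E3).
  { apply bounded_separated_unit_vectors; auto. intros. apply eigenspace_add; auto;
      apply (eigenspace_scal T _ (mkC _ 0)); auto. }
  split.
  - exists (e 0%nat). split; [|auto]. intros Z. specialize (E2 0%nat).
    rewrite Z, hnorm_zero in E2. lra.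
  - intros n. exists e. split; [auto|]. apply orthonormal_lin_indep; auto.
Qed.

Lemma hnorm_vsub_unit_sqr (x y : X) : hnorm x = 1 -> hnorm y = 1 ->
  hnorm (vsub x y) * hnorm (vsub x y) = 2 - 2 * ip x y.
Proof.
  intros H1 H2. rewrite hnorm_sqr. ip_expand. rewrite <- !hnorm_sqr, H1, H2, (ip_sym y x). ring.
Qed.

(** Orthonormal eigenvectors have zero defect and mutual distance [sqrt 2], more than the separation
    1 claimed. *)
Lemma infinite_multiplicity_singular T lam :
  is_subspace T -> infinite_multiplicity T lam -> singular T lam.
Proof.
  intros Hs HI. destruct (orthonormal_sequence (eigenspace T lam)) as (e & E1 & E2 & E3).
  { apply infinite_dim_unit_vectors; [| |exact HI]; intros;
      [apply eigenspace_add|apply eigenspace_scal]; auto. }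
  exists e, (fun n => vscal lam (e n)), 1, 1. split; [lra|]. split; [exact E1|].
  split; [intros n; rewrite E2; lra|]. split.
  - intros eps He. exists 0%nat. intros.
    replace (vsub _ _) with (@vzero X) by vec_eq. rewrite hnorm_zero. lra.
  - intros j k Hjk. rewrite hnorm_vsub_sym.
    pose proof (hnorm_vsub_unit_sqr (e k) (e j) (E2 k) (E2 j)) as H.
    unfold ip in H. rewrite (E3 j k Hjk) in H. simpl in H.
    pose proof (hnorm_pos (vsub (e k) (e j))). nra.
Qed.

(* By symmetry [(m - m') <x, x'>] only sees the two defects [f - m x] and [f' - m' x']. *)
Lemma approx_eigenvectors_almost_orthogonal T m m' x f x' f' :
  self_adjoint T -> T (x, f) -> T (x', f') -> hnorm x = 1 -> hnorm x' = 1 ->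
  Rabs (m - m') * Rabs (ip x x') <=
    hnorm (vsub f (vscal (mkC m 0) x)) + hnorm (vsub f' (vscal (mkC m' 0) x')).
Proof.
  intros Hsa H1 H2 N1 N2. rewrite <- Rabs_mult.
  pose proof (f_equal Cre (self_adjoint_symmetric T _ _ _ _ Hsa H1 H2)) as E.
  fold (ip f x') (ip x f') in E.
  change (vscal (mkC m 0) x) with (rsc m x). change (vscal (mkC m' 0) x') with (rsc m' x').
  replace ((m - m') * ip x x')
    with (ip x (vsub f' (rsc m' x')) - ip (vsub f (rsc m x)) x') by (ip_expand; lra).
  pose proof (cauchy_schwarz x (vsub f' (rsc m' x'))) as A.
  pose proof (cauchy_schwarz (vsub f (rsc m x)) x') as B.
  rewrite N1 in A. rewrite N2 in B.
  pose proof (Rabs_triang (ip x (vsub f' (rsc m' x'))) (- ip (vsub f (rsc m x)) x')) as C.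
  rewrite Rabs_Ropp in C. unfold Rminus. lra.
Qed.

(** Spectral points [m n] approach [l] with distances more than halving, so they are far apart
    relative to the defects of their approximate eigenvectors, which are therefore almost
    orthogonal. *)
Lemma accumulation_singular T lam :
  is_subspace T -> self_adjoint T -> closed_rel T ->
  in_spectrum T lam -> accumulation_pt T lam -> singular T lam.
Proof.
  intros Hs Hsa Hcl Hsp Hacc.
  pose proof (spectrum_real T lam Hs Hsa Hcl Hsp) as Hre.
  destruct lam as [l li]. simpl in Hre. subst li.
  (* The condition [eta > 0] sits under the existential so that [choice] yields a function on all
     reals, which the recursion for [m] can iterate. *)
  assert (Hnx : forall eta, exists m, eta > 0 ->
     in_spectrum T (mkC m 0) /\ 0 < Rabs (m - l) < eta).
  { intros eta. destruct (Rlt_dec 0 eta) as [P|P]; [|exists 0; intros; lra].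
    destruct (Hacc eta P) as ([m mi] & H1 & H2 & H3).
    pose proof (spectrum_real T _ Hs Hsa Hcl H1) as R. simpl in R. subst mi.
    exists m. intros _. split; [exact H1|]. split.
    - apply Rabs_pos_lt. intros Z. apply H2. f_equal. lra.
    - replace (Csub (mkC m 0) (mkC l 0)) with (mkC (m - l) 0) in H3
        by (apply Cx_ext; simpl; ring).
      rewrite Cabs_real in H3. exact H3. }
  destruct (choice _ Hnx) as [nx Hn].
  set (m := fix m n := match n with O => nx 1 | S k => nx (Rabs (m k - l) / 2) end).
  assert (Hm : forall n, in_spectrum T (mkC (m n) 0) /\ 0 < Rabs (m n - l)).
  { induction n as [|n [_ IH]].
    - destruct (Hn 1 ltac:(lra)) as [? [? ?]]. auto.
    - destruct (Hn (Rabs (m n - l) / 2) ltac:(lra)) as [? [? ?]]. auto. }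
  assert (Hm2 : forall n, Rabs (m (S n) - l) < Rabs (m n - l) / 2).
  { intros n. destruct (Hm n) as [_ P].
    destruct (Hn (Rabs (m n - l) / 2) ltac:(lra)) as [_ [_ H]]. exact H. }
  assert (Hdec : forall j k, (j < k)%nat -> Rabs (m k - l) < Rabs (m j - l) / 2).
  { intros j k L. induction L; [apply Hm2|]. specialize (Hm2 m0).
    destruct (Hm j) as [_ Pj]. lra. }
  assert (Hto0 : forall n, Rabs (m n - l) <= / (INR n + 1)).
  { induction n as [|n IH].
    - simpl. rewrite Rplus_0_l, Rinv_1. destruct (Hn 1 ltac:(lra)) as [_ [_ H]]. left; exact H.
    - specialize (Hm2 n). rewrite S_INR. pose proof (pos_INR n) as Pn.
      assert (/ (INR n + 1) / 2 <= / (INR n + 1 + 1)); [|lra].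
      unfold Rdiv. rewrite <- Rinv_mult. apply Rinv_le_contravar; lra. }
  (* The factor [1 / 8] keeps the sum of the defects at [j < k] below [Rabs (m j - l) / 4]. As [m j]
     and [m k] differ by at least [Rabs (m j - l) / 2], the inner product is at most [1 / 2] and the
     squared distance at least 1. *)
  assert (Hap : forall n, exists p : X * X, T p /\ hnorm (fst p) = 1 /\
    hnorm (vsub (snd p) (vscal (mkC (m n) 0) (fst p))) < Rabs (m n - l) / 8).
  { intros n. destruct (Hm n) as [H P].
    destruct (spectrum_approx_eigenvector T (mkC (m n) 0) (Rabs (m n - l) / 8))
      as (x & f & H1 & H2 & H3); auto; [lra|]. exists (x, f). auto. }
  destruct (choice _ Hap) as [p Hp].
  assert (Hdef : forall n, hnorm (vsub (snd (p n)) (vscal (mkC l 0) (fst (p n))))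
    <= 2 * / (INR n + 1)).
  { intros n. destruct (Hp n) as (_ & H1 & H2).
    replace (vsub (snd (p n)) (vscal (mkC l 0) (fst (p n))))
      with (vadd (vsub (snd (p n)) (vscal (mkC (m n) 0) (fst (p n)))) (rsc (m n - l) (fst (p n))))
      by vec_eq.
    eapply Rle_trans; [apply hnorm_add|]. rewrite hnorm_rsc, H1.
    specialize (Hto0 n). destruct (Hm n). lra. }
  exists (fun n => fst (p n)), (fun n => snd (p n)), 1, 1. split; [lra|].
  split; [intros n; rewrite <- surjective_pairing; apply Hp|].
  split; [intros n; right; apply Hp|]. split.
  - intros eps He. destruct (INR_inv_small (eps / 4)) as [N HN]; [lra|].
    exists N. intros i j Hi Hj. eapply Rle_lt_trans; [apply hnorm_sub|].
    pose proof (HN i Hi). pose proof (HN j Hj). pose proof (Hdef i). pose proof (Hdef j). lra.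
  - intros j k Hjk. destruct (Hp j) as (Tj & Nj & Ej). destruct (Hp k) as (Tk & Nk & Ek).
    rewrite (surjective_pairing (p j)) in Tj. rewrite (surjective_pairing (p k)) in Tk.
    pose proof (approx_eigenvectors_almost_orthogonal T (m j) (m k) _ _ _ _ Hsa Tj Tk Nj Nk) as A.
    specialize (Hdec j k Hjk). destruct (Hm j) as [_ Pj].
    assert (D : Rabs (m j - l) / 2 <= Rabs (m j - m k)).
    { pose proof (Rabs_triang (m j - m k) (m k - l)) as Tr.
      replace (m j - m k + (m k - l)) with (m j - l) in Tr by ring. lra. }
    pose proof (hnorm_vsub_unit_sqr _ _ Nj Nk) as Sq.
    pose proof (Rle_abs (ip (fst (p j)) (fst (p k)))) as I.
    pose proof (Rabs_pos (ip (fst (p j)) (fst (p k)))) as I0.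
    pose proof (hnorm_pos (vsub (fst (p j)) (fst (p k)))) as P.
    assert (I1 : Rabs (ip (fst (p j)) (fst (p k))) <= 1 / 2).
    { apply Rnot_lt_le. intros L.
      assert (Rabs (m j - l) / 2 * (1 / 2) <= Rabs (m j - m k) * Rabs (ip (fst (p j)) (fst (p k))))
        by (apply Rmult_le_compat; lra). lra. }
    nra.
Qed.

Lemma ess_spectrum_singular T lam :
  is_subspace T -> self_adjoint T -> closed_rel T -> in_ess_spectrum T lam -> singular T lam.
Proof.
  intros Hs Hsa Hcl [Hsp [Ha|(_ & _ & HI)]].
  - apply accumulation_singular; auto.
  - apply infinite_multiplicity_singular; auto.
Qed.

(** * Singular sequences under compact perturbation *)

Lemma orth_proj_fixes T P p : is_subspace T -> orth_proj T P -> T p -> P p = p.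
Proof.
  intros Hs HP HT. destruct (HP p) as [H1 H2].
  destruct (P p) as [a b], p as [x f].
  (* The vector [p - P p] lies in [T] and is orthogonal to [T], so it is tested against itself. *)
  specialize (H2 _ (subspace_sub T _ _ _ _ Hs HT H1)). apply (f_equal Cre) in H2.
  unfold inner2 in H2. simpl in H2.
  fold (ip (vsub x a) (vsub x a)) (ip (vsub f b) (vsub f b)) in H2.
  pose proof (ip_pos (vsub x a)). pose proof (ip_pos (vsub f b)).
  assert (E1 : vsub x a = vzero) by (apply ip_def; lra).
  assert (E2 : vsub f b = vzero) by (apply ip_def; lra).
  f_equal.
  - replace x with (vadd (vsub x a) a) by vec_eq. rewrite E1. vec_eq.
  - replace f with (vadd (vsub f b) b) by vec_eq. rewrite E2. vec_eq.
Qed.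

Lemma cauchy_add (u v : nat -> X) :
  cauchy_seq u -> cauchy_seq v -> cauchy_seq (fun n => vadd (u n) (v n)).
Proof.
  intros Hu Hv. destruct (cauchy_conv u Hu) as [x Hx]. destruct (cauchy_conv v Hv) as [y Hy].
  apply conv_cauchy with (vadd x y). apply conv_add; auto.
Qed.

(** Since [PT] fixes the pairs [(x n, f n)], the compact difference sends them to their corrections
    [(x n, f n) - PS (x n, f n)], which converge along a subsequence. *)
Lemma singular_compact_perturbation T S PT PS lam :
  is_subspace T -> orth_proj T PT -> orth_proj S PS ->
  compact_op (fun z => sub2 (PT z) (PS z)) -> singular T lam -> singular S lam.
Proof.
  intros HsT HPT HPS HK (x & f & M & s & Ps & HT & HM & HC & Hsep).
  destruct (cauchy_bounded _ HC) as [G HG].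
  assert (Hbd : exists M', forall n, norm2 (x n, f n) <= M').
  { exists (M + (G + Cabs lam * M)). intros n. eapply Rle_trans; [apply norm2_le|]. simpl.
    pose proof (HM n). specialize (HG n).
    pose proof (hnorm_le_sub (f n) (vscal lam (x n))) as A. rewrite hnorm_vscal in A.
    assert (Cabs lam * hnorm (x n) <= Cabs lam * M)
      by (apply Rmult_le_compat_l; [apply sqrt_pos|auto]). lra. }
  destruct (HK (fun n => (x n, f n)) Hbd) as (phi & l & Hphi & Hl).
  assert (Hinc := strictly_increasing phi Hphi).
  assert (Hge : forall n, (n <= phi n)%nat).
  { induction n; [lia|]. specialize (Hphi n). lia. }
  set (q := fun n => PS (x (phi n), f (phi n))).
  set (k1 := fun n => vsub (x (phi n)) (fst (q n))).
  set (k2 := fun n => vsub (f (phi n)) (snd (q n))).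
  assert (HKe : forall n, sub2 (PT (x (phi n), f (phi n))) (PS (x (phi n), f (phi n)))
     = (k1 n, k2 n)).
  { intros n. rewrite (orth_proj_fixes T PT); auto. }
  assert (C1 : conv_to k1 (fst l)).
  { intros eps He. destruct (Hl eps He) as [N HN]. exists N. intros n Hn. specialize (HN n Hn).
    rewrite HKe in HN. eapply Rle_lt_trans; [apply (norm2_fst (sub2 (k1 n, k2 n) l))|auto]. }
  assert (C2 : conv_to k2 (snd l)).
  { intros eps He. destruct (Hl eps He) as [N HN]. exists N. intros n Hn. specialize (HN n Hn).
    rewrite HKe in HN. eapply Rle_lt_trans; [apply (norm2_snd (sub2 (k1 n, k2 n) l))|auto]. }
  destruct (cauchy_bounded _ (conv_cauchy _ _ C1)) as [M1 HM1].
  (* Beyond [N] the corrections [k1] differ by less than [s / 2], so half of the separation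
     survives. *)
  destruct (conv_cauchy _ _ C1 (s / 2)) as [N HN]; [lra|].
  assert (CC : cauchy_seq (fun n => vsub (snd (q n)) (vscal lam (fst (q n))))).
  (* The defect of [q n] is the old defect plus [lam * k1 n - k2 n]. *)
  { assert (D : cauchy_seq (fun n => vadd (vsub (f (phi n)) (vscal lam (x (phi n))))
        (vsub (vscal lam (k1 n)) (k2 n)))).
    { apply cauchy_add.
      - intros eps He. destruct (HC eps He) as [N' HN']. exists N'. intros i j Hi Hj.
        pose proof (Hge i). pose proof (Hge j). apply HN'; lia.
      - apply conv_cauchy with (vsub (vscal lam (fst l)) (snd l)).
        apply conv_sub; [apply conv_vscal|]; auto. }
    intros eps He. destruct (D eps He) as [N' HN']. exists N'. intros i j Hi Hj.
    specialize (HN' i j Hi Hj).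
    replace (vsub (vsub (snd (q i)) (vscal lam (fst (q i)))) (vsub (snd (q j)) (vscal lam (fst (q j)))))
      with (vsub (vadd (vsub (f (phi i)) (vscal lam (x (phi i)))) (vsub (vscal lam (k1 i)) (k2 i)))
        (vadd (vsub (f (phi j)) (vscal lam (x (phi j)))) (vsub (vscal lam (k1 j)) (k2 j))))
      by (unfold k1, k2; vec_eq).
    exact HN'. }
  exists (fun n => fst (q (N + n)%nat)), (fun n => snd (q (N + n)%nat)), (M + M1), (s / 2).
  split; [lra|]. split; [|split; [|split]].
  - intros n. rewrite <- surjective_pairing. apply HPS.
  - intros n. replace (fst (q (N + n)%nat)) with (vsub (x (phi (N + n)%nat)) (k1 (N + n)%nat))
      by (unfold k1; vec_eq).
    eapply Rle_trans; [apply hnorm_sub|]. apply Rplus_le_compat; auto.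
  - intros eps He. destruct (CC eps He) as [N' HN']. exists N'. intros i j Hi Hj. apply HN'; lia.
  - intros j k Hjk.
    specialize (Hsep (phi (N + j)%nat) (phi (N + k)%nat) ltac:(apply Hinc; lia)).
    specialize (HN (N + j)%nat (N + k)%nat ltac:(lia) ltac:(lia)).
    pose proof (hnorm_le_sub (vsub (x (phi (N + j)%nat)) (x (phi (N + k)%nat)))
      (vsub (fst (q (N + j)%nat)) (fst (q (N + k)%nat)))) as A.
    replace (vsub (vsub (x (phi (N + j)%nat)) (x (phi (N + k)%nat)))
      (vsub (fst (q (N + j)%nat)) (fst (q (N + k)%nat))))
      with (vsub (k1 (N + j)%nat) (k1 (N + k)%nat)) in A by (unfold k1; vec_eq).
    lra.
Qed.

Lemma compact_perturbation_sym T S : compact_perturbation T S -> compact_perturbation S T.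
Proof.
  intros (HcT & HcS & PT & PS & HT & HS & HK). split; [exact HcS|]. split; [exact HcT|].
  exists PS, PT. split; [exact HS|]. split; [exact HT|].
  intros u Hu. destruct (HK u Hu) as (phi & l & H1 & H2).
  (* The reversed difference of projections converges along the same subsequence to the negated
     limit. *)
  exists phi, (vsub vzero (fst l), vsub vzero (snd l)). split; [exact H1|].
  intros eps He. destruct (H2 (eps / 2) ltac:(lra)) as [N HN]. exists N. intros n Hn.
  specialize (HN n Hn).
  set (a := PT (u (phi n))) in *. set (b := PS (u (phi n))) in *.
  replace (norm2 (sub2 (sub2 b a) (vsub vzero (fst l), vsub vzero (snd l))))
    with (norm2 (sub2 (sub2 a b) l)); [lra|].
  unfold norm2, inner2. simpl. do 2 f_equal.
  - change (ip (vsub (vsub (fst a) (fst b)) (fst l)) (vsub (vsub (fst a) (fst b)) (fst l))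
      = ip (vsub (vsub (fst b) (fst a)) (vsub vzero (fst l)))
           (vsub (vsub (fst b) (fst a)) (vsub vzero (fst l)))). ip_expand. ring.
  - change (ip (vsub (vsub (snd a) (snd b)) (snd l)) (vsub (vsub (snd a) (snd b)) (snd l))
      = ip (vsub (vsub (snd b) (snd a)) (vsub vzero (snd l)))
           (vsub (vsub (snd b) (snd a)) (vsub vzero (snd l)))). ip_expand. ring.
Qed.

Lemma ess_spectrum_compact_perturbation T S lam :
  is_subspace T -> is_subspace S -> self_adjoint T -> self_adjoint S ->
  compact_perturbation T S -> in_ess_spectrum T lam -> in_ess_spectrum S lam.
Proof.
  intros HsT HsS HaT HaS (HcT & HcS & PT & PS & HPT & HPS & HK) H.
  apply singular_ess_spectrum; auto.
  apply singular_compact_perturbation with T PT PS; auto.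
  apply ess_spectrum_singular; auto.
Qed.

End Singular.

Theorem theorem5p1 (X : Hilbert) (T S : relation2 X) :
  is_subspace T -> is_subspace S ->
  self_adjoint T -> self_adjoint S ->
  compact_perturbation T S ->
  (forall lam, in_ess_spectrum T lam <-> in_ess_spectrum S lam) /\
  ((forall lam, ~ in_ess_spectrum S lam) <-> (forall lam, ~ in_ess_spectrum T lam)).
Proof.
  intros HsT HsS HaT HaS HTS.
  assert (E : forall lam, in_ess_spectrum T lam <-> in_ess_spectrum S lam).
  { intros lam. split; apply ess_spectrum_compact_perturbation; auto.
    apply compact_perturbation_sym, HTS. }
  split; [exact E|].
  split; intros H lam Hl; apply (H lam), E, Hl.
Qed.
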